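(* Let $d\ge2$. Let $\Omega\subset\mathbb{R}^d_+$ be open and bounded with Lipschitz boundary, and let $f:\mathbb{R}^d\to[0,\infty)$ be a probability density such that there is a continuous nondecreasing $m:[0,\infty)\to[0,\infty)$ with $m(0)=0$ and $|f(x)-f(y)|\le m(|x-y|)$ for $x,y\in\Omega$, and $f(x)=0$ for $x\notin\Omega$. Let $X_1,X_2,\dots$ be i.i.d. with density $f$. Then for every $z\in\mathbb{R}^d$, \[\liminf_{n\to\infty}n^{-1/d}u_n(z)\ge c_dU(z)\quad\text{almost surely.}\]
   Context: $x\leqq y$ means $x_i\le y_i$ for all $i$; $\mathbb{R}^d_+=\{x:x_i>0\ \forall i\}$. $u_n(x)$ is the length of a longest chain (subset totally ordered by $\leqq$) in $\{X_i: 1\le i\le n,\ X_i\leqq x\}$. $\mathcal{A}$ is the set of $\gamma\in C^1([0,1];\mathbb{R}^d)$ with all components of $\gamma'(t)$ nonnegative and $\gamma'(t)\ne0$ for every $t$; $U(x)=\sup\{\int_0^1 f(\gamma(t))^{1/d}(\gamma_1'(t)\cdots\gamma_d'(t))^{1/d}dt:\gamma\in\mathcal{A},\ \gamma(t)\leqq x\ \forall t\}$. $c_d$ is the positive constant such that, for i.i.d. uniform points on $[0,1]^d$, $n^{-1/d}$ times the length of a longest chain among the first $n$ points converges almost surely to $c_d$. *)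

(* Defs.v *)
From HB Require Import structures.
From mathcomp Require Import all_boot all_order all_algebra.
From mathcomp Require Import all_classical all_reals all_analysis.
Set Implicit Arguments. Unset Strict Implicit. Unset Printing Implicit Defensive.
Import Order.TTheory GRing.Theory Num.Theory.
Import numFieldNormedType.Exports.
Local Open Scope classical_set_scope.
Local Open Scope ring_scope.

Section Defs.
Variables (R : realType) (d : nat).

Notation vec := 'rV[R]_d.

Definition lev (x y : vec) : bool := [forall i, x ord0 i <= y ord0 i].

Definition eucl (x : vec) : R := Num.sqrt (\sum_(i < d) x ord0 i ^+ 2).

Definition Rd := g_sigma_algebraType (@open vec).

Definition setc (x : vec) (k : nat) (t : R) : vec :=
  \row_j (if (j : nat) == k then t else x ord0 j).

(* Iterated one-dimensional Lebesgue integrals; by Tonelli, for a nonnegative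
   Borel g, [intRd g] is the d-dimensional Lebesgue integral of g over R^d. *)
Fixpoint iint (k : nat) (g : vec -> \bar R) (x : vec) : \bar R :=
  match k with
  | 0 => g x
  | k.+1 => (\int[lebesgue_measure]_(t in [set: R]) iint k g (setc x k t))%E
  end.

Definition intRd (g : vec -> \bar R) : \bar R := iint d g 0.

Definition prob_density (f : vec -> R) : Prop :=
  measurable_fun [set: Rd] (f : Rd -> R) /\ (forall x, 0 <= f x) /\
  intRd (fun x => (f x)%:E) = 1%E.

Definition iid_density (dT : measure_display) (T : measurableType dT)
    (P : probability T R) (X : nat -> T -> vec) (f : vec -> R) : Prop :=
  (forall i, measurable_fun [set: T] (X i : T -> Rd)) /\
  (forall i (B : set Rd), measurable B ->
     P (X i @^-1` B) = intRd (fun x => (f x * \1_B x)%:E)) /\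
  (forall (n : nat) (B : nat -> set Rd), (forall j, measurable (B j)) ->
     P (\bigcap_(j in `I_n) (X j @^-1` B j)) =
     (\prod_(j < n) P (X j @^-1` B j))%E).

Definition chain_len (T : Type) (X : nat -> T -> vec) (n : nat) (A : pred vec)
    (w : T) : nat :=
  \max_(S : {set 'I_n} |
          [forall i in S, A (X i w)] &&
          [forall i in S, forall j in S,
             [&& lev (X i w) (X j w) || lev (X j w) (X i w)
               & (X i w == X j w) ==> (i == j)]]) #|S|.

Definition u_n (T : Type) (X : nat -> T -> vec) (n : nat) (x : vec) (w : T) : nat :=
  chain_len X n (fun y => lev y x) w.

Definition is_cd (c : R) : Prop :=
  0 < c /\
  exists (dT : measure_display) (T : measurableType dT) (P : probability T R)
         (Y : nat -> T -> vec),
    iid_density P Y (fun x => if [forall i, (0 <= x ord0 i <= 1)] then 1 else 0) /\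
    {ae P, forall w, (fun n : nat => (n%:R `^ (- (d%:R)^-1)) *
                        (chain_len Y n (fun _ => true) w)%:R) @ \oo --> c}.

(* Lipschitz boundary: near every boundary point, in suitable rotated
   coordinates, Omega is the region below the graph of a Lipschitz function
   of the other d-1 coordinates. *)
Definition lipschitz_boundary (O : set vec) : Prop :=
  forall p, closure O p -> ~ O p ->
  exists (r : R) (Q : 'M[R]_d) (k : 'I_d) (g : vec -> R) (L : R),
    0 < r /\ Q *m Q^T = 1%:M /\
    (forall y y' : vec, (forall i, i != k -> y ord0 i = y' ord0 i) -> g y = g y') /\
    (forall y y' : vec, `|g y - g y'| <= L * eucl (y - y')) /\
    (forall x, eucl (x - p) < r ->
       (O x <-> ((x - p) *m Q) ord0 k < g ((x - p) *m Q))).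

Definition admissible (gam : R -> vec) : Prop :=
  (forall t, 0 <= t <= 1 -> derivable gam t 1) /\
  {within `[0, 1], continuous (derive1 gam)} /\
  (forall t, 0 <= t <= 1 -> (forall i, 0 <= (derive1 gam t) ord0 i) /\ derive1 gam t != 0).

Definition curve_integral (f : vec -> R) (gam : R -> vec) : \bar R :=
  (\int[lebesgue_measure]_(t in `[(0:R)%R, (1:R)%R]%classic)
     ((f (gam t)) `^ (d%:R^-1) * (\prod_(i < d) (derive1 gam t) ord0 i) `^ (d%:R^-1))%:E)%E.

Definition Ufun (f : vec -> R) (x : vec) : \bar R :=
  ereal_sup [set curve_integral f gam | gam in
             [set gam | admissible gam /\ forall t, 0 <= t <= 1 -> lev (gam t) x]].

End Defs.

(* Main.v *)
Require Import Defs.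
From HB Require Import structures.
From mathcomp Require Import all_boot all_order all_algebra.
From mathcomp Require Import all_classical all_reals all_analysis.
From mathcomp Require Import measurable_realfun.
From mathcomp Require Import lra ring.
Import Order.TTheory GRing.Theory Num.Theory.
Import numFieldNormedType.Exports.
Local Open Scope classical_set_scope.
Local Open Scope ring_scope.

(** Let [gamma] be an admissible curve below [z]. The boxes spanned by the points
    [gamma (j / N)] are ordered one after the other, so chains found in them
    concatenate. If [f >= mu] on a box of volume [V], then almost surely its
    longest chain is at least [(c - o(1)) (mu V n) ^ (1/d)]; summing gives
    [c] times the lower sum of the [(mu_j V_j) ^ (1/d)]. As [f] is nonnegative
    and continuous on the open set [Omega], it is lower semicontinuous, so Fatou's
    lemma bounds the curve integral by the liminf of these lower sums.

    For the bound in one box, cut the box and the unit cube into [m ^ d] cells.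
    The cell labels of the [X_i] dominate [p = mu V] times the uniform law, so on
    [M] points their law is a mixture, over the Bernoulli([p]) set of kept
    indices, of laws in which the kept labels are i.i.d. uniform. Up to
    coordinate ties (probability [O(M ^ 2 / m)]), kept labels behave like the
    uniform sample that defines [c]; the number of kept indices is controlled by
    Chernoff's bound. *)

Set Implicit Arguments. Unset Strict Implicit. Unset Printing Implicit Defensive.

(** * Finite expectations and thinning *)

Section FiniteExpectation.
Context {R : realType}.

(** Expectation of [F] over [M] independent labels with weights [nu]. Peeling off the first label
    outermost makes every fact below an induction on [M], with no product measure. *)
Fixpoint iexp (K : finType) (nu : K -> R) (M : nat) (F : seq K -> R) : R :=
  if M is M'.+1 then \sum_k nu k * iexp nu M' (fun s => F (k :: s)) else F [::].

Section Theory.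
Variables (K : finType) (nu : K -> R).
Hypothesis nu0 : forall k, 0 <= nu k.
Hypothesis nu1 : \sum_k nu k = 1.

Lemma ler_iexp M F G : (forall s, size s = M -> F s <= G s) ->
  iexp nu M F <= iexp nu M G.
Proof.
elim: M F G => [|M IH] F G FG /=; first exact: FG.
by apply: ler_sum => k _; apply: ler_wpM2l => //; apply: IH => s sM; apply: FG; rewrite /= sM.
Qed.

Lemma eq_iexp M F G : (forall s, size s = M -> F s = G s) ->
  iexp nu M F = iexp nu M G.
Proof.
elim: M F G => [|M IH] F G FG /=; first exact: FG.
by apply: eq_bigr => k _; congr (_ * _); apply: IH => s sM; apply: FG; rewrite /= sM.
Qed.

Lemma iexp_cst M c : iexp nu M (fun _ => c) = c.
Proof. by elim: M => //= M ->; rewrite -mulr_suml nu1 mul1r. Qed.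

Lemma iexpZ M c F : iexp nu M (fun s => c * F s) = c * iexp nu M F.
Proof.
elim: M F => [//|M IH] F /=; rewrite mulr_sumr.
by apply: eq_bigr => k _; rewrite IH mulrCA.
Qed.

Lemma iexp_sum (I : Type) (r : seq I) (P : pred I) M (F : I -> seq K -> R) :
  iexp nu M (fun s => \sum_(i <- r | P i) F i s) =
  \sum_(i <- r | P i) iexp nu M (F i).
Proof.
elim: M F => [//|M IH] F /=; rewrite exchange_big.
by apply: eq_bigr => k _; rewrite IH mulr_sumr.
Qed.

Lemma iexpD M F G : iexp nu M (fun s => F s + G s) = iexp nu M F + iexp nu M G.
Proof.
elim: M F G => [//|M IH] F G /=; rewrite -big_split.
by apply: eq_bigr => k _; rewrite IH mulrDr.
Qed.

(** A further label integrates out because [nu] has mass 1. In the thinning argument this pads a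
    sequence shortened by a dropped label. *)
Lemma iexpS_ge M F : (forall s k, F s <= F (rcons s k)) ->
  iexp nu M F <= iexp nu M.+1 F.
Proof.
elim: M F => [|M IH] F FS.
  rewrite /= -[leLHS]mul1r -nu1 mulr_suml.
  by apply: ler_sum => k _; apply: ler_wpM2l => //; exact: (FS [::]).
rewrite [leLHS]/= [leRHS]/=; apply: ler_sum => k _; apply: ler_wpM2l => //.
by apply: IH => s k'; apply: FS.
Qed.

Lemma iexp_nth M j (g : K -> R) x0 : (j < M)%N ->
  iexp nu M (fun s => g (nth x0 s j)) = \sum_k nu k * g k.
Proof.
elim: M j => [//|M IH] [|j] jM /=.
  by apply: eq_bigr => k _; rewrite iexp_cst.
by under eq_bigr do rewrite IH //; rewrite -mulr_suml nu1 mul1r.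
Qed.

End Theory.

Definition bern (p : R) (b : bool) : R := if b then p else 1 - p.

Lemma sum_bern p : \sum_b bern p b = 1.
Proof. by rewrite big_bool /= addrC subrK. Qed.

Lemma bern_ge0 p : 0 <= p <= 1 -> forall b, 0 <= bern p b.
Proof. by case/andP => p0 p1 [] /=; rewrite ?subr_ge0. Qed.

(* [nu = p u + (nu - p u)]: each label is kept with probability [p], and then
   it has law [u]; [bs] records the kept positions. *)
Lemma iexp_thinning (K : finType) (nu u : K -> R) (p : R) M
    (F F2 : seq K -> R) (F1 : seq bool -> R) :
  (forall k, 0 <= nu k) -> \sum_k nu k = 1 ->
  (forall k, 0 <= u k) -> \sum_k u k = 1 ->
  0 <= p <= 1 -> (forall k, p * u k <= nu k) ->
  (forall s k, F2 s <= F2 (rcons s k)) ->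
  (forall bs s, size bs = M -> size s = M -> F s <= F1 bs + F2 (mask bs s)) ->
  iexp nu M F <= iexp (bern p) M F1 + iexp u M F2.
Proof.
move=> nu0 nu1 u0 u1 p01 punu.
elim: M F F1 F2 => [|M IH] F F1 F2 F2S FF; first exact: (FF [::] [::]).
have IHt k : iexp nu M (fun s => F (k :: s)) <=
    iexp (bern p) M (fun bs => F1 (true :: bs)) + iexp u M (fun s => F2 (k :: s)).
  apply: IH => [s k'|bs s sb ss]; first exact: (F2S (k :: s)).
  by apply: (FF (true :: bs) (k :: s)); rewrite /= ?sb ?ss.
(* A dropped label leaves the kept sequence as it was, so the induction hypothesis offers only [M]
   labels of law [u]; monotonicity of [F2] supplies the missing one. *)
have IHf k : iexp nu M (fun s => F (k :: s)) <=
    iexp (bern p) M (fun bs => F1 (false :: bs)) + iexp u M.+1 F2.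
  apply: le_trans (lerD (lexx _) (iexpS_ge u0 u1 M F2S)).
  apply: IH => [|bs s sb ss]; first exact: F2S.
  by apply: (FF (false :: bs) (k :: s)); rewrite /= ?sb ?ss.
set E1 := iexp (bern p) M _ in IHt; set E0 := iexp (bern p) M _ in IHf.
set U := iexp u M.+1 F2 in IHf *.
have EU : \sum_k u k * iexp u M (fun s => F2 (k :: s)) = U by [].
rewrite [leLHS]/= [X in X + _]/= big_bool /= -/E1 -/E0.
(* The part [p * u k] of the weight is bounded by [IHt] and the remainder [nu k - p * u k], of total
   mass [1 - p], by [IHf]. *)
apply: (@le_trans _ _ (\sum_k (p * u k * (E1 + iexp u M (fun s => F2 (k :: s))) +
    (nu k - p * u k) * (E0 + U)))).
  apply: ler_sum => k _; rewrite -[X in X * _](subrK (p * u k)) addrC mulrDl.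
  have pu0 : 0 <= p * u k by case/andP: p01 => p0 _; apply: mulr_ge0.
  by apply: lerD; apply: ler_wpM2l => //; rewrite subr_ge0.
rewrite big_split /= -mulr_suml sumrB nu1 -mulr_sumr u1 mulr1.
under eq_bigr do rewrite -mulrA mulrDr.
rewrite -mulr_sumr big_split /= -mulr_suml u1 mul1r EU.
by rewrite le_eqVlt; apply/orP; left; apply/eqP; ring.
Qed.

(** Generating function of a binomial count: each of the first [n] bits contributes the factor
    [1 - p + p * x], and the later ones integrate to 1. *)
Lemma iexp_bern_exp (p x : R) M n : (n <= M)%N ->
  iexp (bern p) M (fun bs => x ^+ count id (take n bs)) = (1 - p + p * x) ^+ n.
Proof.
elim: M n => [|M IH] [|n] nM //=.
  under eq_bigr do rewrite expr0 (iexp_cst (sum_bern p)) mulr1.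
  by rewrite sum_bern expr0.
rewrite big_bool /= exprS.
under [X in p * X]eq_iexp do rewrite add1n exprS.
under [X in (1 - p) * X]eq_iexp do rewrite add0n.
by rewrite iexpZ (IH n nM) mulrA -mulrDl addrC.
Qed.

Definition few (alpha : R) (N : nat) (bs : seq bool) : bool :=
  [exists n : 'I_(size bs).+1,
     (N <= n)%N && ((count id (take n bs))%:R < alpha * n%:R)].

(* Chernoff's bound, summed over all [n >= N]; [rho < 1] comes from
   [expR (- lambda) <= 1 / (1 + lambda)] and [theta (1 + lambda) < 1]. *)
Lemma iexp_few_le (p theta : R) : 0 < p <= 1 -> 0 < theta < 1 ->
  exists2 rho : R, 0 <= rho < 1 &
    forall N M, iexp (bern p) M (fun bs => (few (theta * p) N bs)%:R) <=
                rho ^+ N / (1 - rho).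
Proof.
move=> /andP[p0 p1] /andP[t0 t1].
(* With this [lam], [theta * (1 + lam)] is the midpoint of [theta] and 1, hence still below 1. *)
pose lam := (theta^-1 - 1) / 2.
have lam0 : 0 < lam by rewrite divr_gt0 ?subr_gt0 ?invf_gt1.
have tl : theta * (1 + lam) < 1.
  rewrite /lam mulrDr mulr1 mulrA mulrBr mulr1 divff ?gt_eqF //; lra.
have x_le : expR (- lam) <= (1 + lam)^-1.
  by rewrite expRN lef_pV2 ?posrE ?expR_gt0 ?expR_ge1Dx//; lra.
pose x := expR (- lam).
pose rho := expR (lam * (theta * p)) * (1 - p + p * x).
have q0 : 0 <= 1 - p + p * x.
  by rewrite addr_ge0 ?subr_ge0 ?mulr_ge0 ?expR_ge0// ltW.
have rho0 : 0 <= rho by rewrite mulr_ge0 ?expR_ge0.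
have rho1 : rho < 1.
  have q_le : 1 - p + p * x <= expR (- (p * (1 - x))).
    by apply: le_trans (expR_ge1Dx _); lra.
  apply: (@le_lt_trans _ _ (expR (lam * (theta * p)) * expR (- (p * (1 - x))))).
    by rewrite ler_wpM2l ?expR_ge0.
  rewrite -expRD expR_lt1.
  have -> : lam * (theta * p) + - (p * (1 - x)) = p * (lam * theta - 1 + x) by ring.
  rewrite pmulr_rlt0 //; apply: (@le_lt_trans _ _ (lam * theta - 1 + (1 + lam)^-1)).
    by rewrite lerD2l.
  have l1 : 0 < 1 + lam by lra.
  rewrite -(pmulr_llt0 _ l1) mulrDl mulVf ?gt_eqF //.
  have -> : (lam * theta - 1) * (1 + lam) + 1 = lam * (theta * (1 + lam) - 1) by ring.
  by rewrite pmulr_rlt0 // subr_lt0.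
exists rho => [|N M]; first by rewrite rho0.
(* Union bound over the prefix lengths from [N] to [M], each costing at most [rho ^+ n] by the
   exponential Markov inequality. The geometric tail is summed first. *)
apply: (@le_trans _ _ (\sum_(n < M.+1 | (N <= n)%N) rho ^+ n)); last first.
  have geo L : \sum_(0 <= n < L) rho ^+ n <= (1 - rho)^-1.
    have d0 : 0 < 1 - rho by rewrite subr_gt0.
    rewrite -[leRHS]mul1r ler_pdivlMr // mulrC.
    rewrite big_mkord -opprB mulNr -subrX1 opprB.
    by rewrite lerBlDr lerDl exprn_ge0.
  rewrite -(big_mkord (fun n => N <= n)%N (fun n => rho ^+ n)).
  have [NM|MN] := leqP N M.+1; last first.
    rewrite big_nat_cond big_pred0 ?mulr_ge0 ?exprn_ge0 ?invr_ge0 ?subr_ge0 ?(ltW rho1) //.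
    by move=> n; apply: contraTF MN => /andP[/andP[_ nM] Nn]; rewrite -leqNgt (leq_trans Nn) // ltnW.
  rewrite (big_cat_nat (leq0n N) NM) //= big_nat_cond big_pred0 ?add0r; last first.
    by move=> n; apply/negP => /andP[/andP[_ +]]; rewrite ltnNge => /negbTE->.
  rewrite -{1}[N]add0n big_addn.
  under eq_bigl do rewrite leq_addl.
  under eq_bigr do rewrite exprD.
  by rewrite -mulr_suml mulrC ler_wpM2l ?exprn_ge0.
have -> : \sum_(n < M.+1 | (N <= n)%N) rho ^+ n = iexp (bern p) M (fun bs =>
   \sum_(n < M.+1 | (N <= n)%N)
     (expR (lam * (theta * p)) ^+ n * x ^+ count id (take n bs))).
  rewrite iexp_sum; apply: eq_bigr => n _.
  by rewrite iexpZ iexp_bern_exp -?exprMn // -ltnS.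
apply: ler_iexp; first by apply: bern_ge0; rewrite p1 ltW.
move=> bs sb; have sum0 : 0 <= \sum_(n < M.+1 | (N <= n)%N)
     (expR (lam * (theta * p)) ^+ n * x ^+ count id (take n bs)).
  by apply: sumr_ge0 => n _; rewrite mulr_ge0 ?exprn_ge0 ?expR_ge0.
rewrite /few; case: existsP => [|_] //= -[].
rewrite sb => n /andP[Nn cn].
(* At the offending [n] the exponent [lam * (theta * p * n - count)] is nonnegative, so this single
   term already dominates the indicator. *)
rewrite (bigD1 n) //=.
rewrite -[leLHS]addr0 lerD //; last first.
  by apply: sumr_ge0 => i _; rewrite mulr_ge0 ?exprn_ge0 ?expR_ge0.
rewrite -!expRM_natl -expRD -[leLHS]expR0 ler_expR.
rewrite mulrN mulrCA [X in _ - X]mulrC -mulrBr.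
by apply: mulr_ge0; [exact: ltW | rewrite subr_ge0 mulrC; exact: ltW].
Qed.

End FiniteExpectation.

(** * Short chains in prefixes of label sequences *)

Section ShortChains.
Context {R : realType}.
Implicit Types (a r : R) (N : nat).

(** An event of the label sequence alone, so that [iexp] measures it. Ranging over prefixes makes it
    monotone under appending labels, as thinning requires. *)
Definition short (K : eqType) (C : pred (seq K)) a r N (s : seq K) : bool :=
  `[< exists n : nat, (N <= n <= size s)%N /\
      forall t, subseq t (take n s) -> C t ->
        (size t)%:R < a * n%:R `^ r >].

Lemma short_rcons (K : eqType) (C : pred (seq K)) a r N s k :
  short C a r N s -> short C a r N (rcons s k).
Proof.
move=> /asboolP[n [/andP[Nn ns] H]]; apply/asboolP; exists n; split.
  by rewrite Nn size_rcons leqW.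
by rewrite -cats1 takel_cat.
Qed.

(** A chain among the kept labels of a prefix is a chain of the prefix. If at least [alpha * n] of
    its [n] labels are kept, the kept ones form a prefix of the masked sequence of length at least
    [N'], and [alpha ^ r * n ^ r] is at most the [r]-th power of that length. *)
Lemma short_mask (K : eqType) (C : pred (seq K)) a r (alpha : R) N N' bs s :
  0 <= a -> 0 <= r -> 0 <= alpha -> N'%:R <= alpha * N%:R -> size bs = size s ->
  short C (a * alpha `^ r) r N s -> few alpha N bs || short C a r N' (mask bs s).
Proof.
move=> a0 r0 al0 NN ss /asboolP[n [/andP[Nn ns] H]].
have nbs : (n <= size bs)%N by rewrite ss.
have [cn|cn] := ltP (count id (take n bs))%:R (alpha * n%:R).
  apply/orP; left; apply/existsP.
  have nb : (n < (size bs).+1)%N by rewrite ltnS.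
  by exists (Ordinal nb); rewrite /= Nn cn.
apply/orP; right; apply/asboolP; exists (count id (take n bs)).
have szt : size (take n bs) = size (take n s) by rewrite !size_takel.
have Em : mask bs s = mask (take n bs) (take n s) ++ mask (drop n bs) (drop n s).
  by rewrite -mask_cat // !cat_take_drop.
split.
  rewrite -(ler_nat R) (le_trans NN) /=; last first.
    by apply: le_trans cn; rewrite ler_wpM2l // ler_nat.
  by rewrite Em size_cat size_mask // leq_addr.
move=> t; rewrite Em take_size_cat ?size_mask // => tm et.
apply: lt_le_trans (H t (subseq_trans tm (mask_subseq _ _)) et) _.
rewrite -mulrA ler_wpM2l // -powRM ?ler0n //.
by rewrite ge0_ler_powR ?nnegrE ?mulr_ge0 ?ler0n.
Qed.

(** Union bound over pairs: a new label meets [M] others, each time with tie probability at most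
    [tau], and [M + M ^ 2 <= (M + 1) ^ 2]. *)
Lemma iexp_tie_le (K : finType) (u : K -> R) (tie : rel K) (tau : R) M :
  (forall k, 0 <= u k) -> \sum_k u k = 1 ->
  \sum_k u k * (\sum_k' u k' * (tie k k')%:R) <= tau ->
  iexp u M (fun s => (~~ pairwise (fun x y => ~~ tie x y) s)%:R) <= M%:R ^+ 2 * tau.
Proof.
move=> u0 u1 utau.
have tau0 : 0 <= tau.
  apply: le_trans utau; apply: sumr_ge0 => k _; rewrite mulr_ge0 //.
  by apply: sumr_ge0 => k' _; rewrite mulr_ge0.
elim: M => [|M IH]; first by rewrite /= expr0n mul0r.
rewrite [leLHS]/=.
apply: (@le_trans _ _ (\sum_k u k * (M%:R * (\sum_k' u k' * (tie k k')%:R) + M%:R ^+ 2 * tau))).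
  apply: ler_sum => k _; apply: ler_wpM2l => //.
  apply: le_trans (lerD (lexx _) IH).
  apply: (@le_trans _ _ (iexp u M (fun s => \sum_(j < M) (tie k (nth k s j))%:R +
      (~~ pairwise (fun x y => ~~ tie x y) s)%:R))).
    apply: ler_iexp => // s sM /=; rewrite negb_and.
    have sum0 : 0 <= \sum_(j < M) (tie k (nth k s j))%:R :> R by apply: sumr_ge0.
    case: (boolP (all _ _)) => [_|/allPn[x xs /negPn kx]] /=; first by rewrite lerDr.
    rewrite -[leLHS]addr0 lerD //.
    have xM : (index x s < M)%N by rewrite -sM index_mem.
    rewrite (bigD1 (Ordinal xM)) //= nth_index // kx lerDl.
    exact: sumr_ge0.
  rewrite iexpD iexp_sum lerD2r.
  rewrite (eq_bigr (fun _ => \sum_k' u k' * (tie k k')%:R)); last first.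
    by move=> j _; apply: (iexp_nth u1 (fun k' => (tie k k')%:R) k (ltn_ord j)).
  by rewrite sumr_const card_ord mulr_natl.
under eq_bigr do rewrite mulrDr mulrCA.
rewrite big_split /= -mulr_sumr -mulr_suml u1 mul1r.
apply: (@le_trans _ _ (M%:R * tau + M%:R ^+ 2 * tau)); first by rewrite lerD2r ler_wpM2l.
rewrite -mulrDl ler_wpM2r // -natr1; have := ler0n R M; nra.
Qed.

End ShortChains.

(** * Laws of cell labels *)

Lemma fsbigT_finType (R : Type) (idx : R) (op : Monoid.com_law idx) (K : finType)
    (F : K -> R) : \big[op/idx]_(k \in [set: K]) F k = \big[op/idx]_k F k.
Proof.
rewrite fsbig_finite; last exact: finite_finset.
apply: perm_big; apply: uniq_perm; rewrite ?finmap.fset_uniq ?index_enum_uniq//.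
by move=> k; rewrite in_fset_set ?mem_index_enum ?in_setT //; exact: finite_finset.
Qed.

Section LabelLaw.
Context {R : realType} (dT dS : measure_display) (T : measurableType dT)
  (S : measurableType dS) (P : probability T R) (Z : nat -> T -> S).
Hypothesis mZ : forall i, measurable_fun [set: T] (Z i).
Hypothesis idZ : forall i (B : set S), measurable B -> P (Z i @^-1` B) = P (Z 0%N @^-1` B).
Hypothesis indepZ : forall (n : nat) (B : nat -> set S), (forall j, measurable (B j)) ->
  P (\bigcap_(j in `I_n) (Z j @^-1` B j)) = (\prod_(j < n) P (Z j @^-1` B j))%E.
Variables (K : finType) (kappa : S -> K).
Hypothesis mkappa : forall k, measurable (kappa @^-1` [set k]).

Definition law (k : K) : R := fine (P (Z 0%N @^-1` (kappa @^-1` [set k]))).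

Let mZp i (B : set S) : measurable B -> measurable (Z i @^-1` B).
Proof. by move=> mB; rewrite -[X in measurable X]setTI; apply: mZ. Qed.

Lemma lawE i k : P (Z i @^-1` (kappa @^-1` [set k])) = (law k)%:E.
Proof. by rewrite idZ // fineK // fin_num_measure //; exact: mZp. Qed.

Lemma law_ge0 k : 0 <= law k.
Proof. exact: fine_ge0. Qed.

Lemma sum_law : \sum_k law k = 1.
Proof.
apply: EFin_inj; rewrite -sumEFin.
under eq_bigr do rewrite -(lawE 0).
rewrite -fsbigT_finType -measure_fin_bigcup; first last.
- by move=> k _; apply: mZp.
- apply/trivIsetP => i j _ _ /eqP ij; rewrite -subset0 => w /= [-> /esym]; exact/nesym.
- exact: finite_finset.
rewrite -(probability_setT P); congr (P _).
by rewrite -subTset => w _; exists (kappa (Z 0%N w)).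
Qed.

Let labels n M w := [seq kappa (Z i w) | i <- iota n M].

(** Constraining the first [n] points by arbitrary sets makes the induction on [M] close: fixing the
    first label of the tail only turns it into one more constraint. The case [n = 0] is the law of
    the labels. *)
Let prob_cyl_labels M n (B : nat -> set S) (F : pred (seq K)) :
  (forall j, measurable (B j)) ->
  let E := \bigcap_(j in `I_n) (Z j @^-1` B j) `&` [set w | F (labels n M w)] in
  measurable E /\
  P E = ((\prod_(j < n) P (Z j @^-1` B j)) * (iexp law M (fun s => (F s)%:R))%:E)%E.
Proof.
move=> + E; rewrite {}/E.
elim: M n B F => [|M IH] n B F mB.
  rewrite /labels /=; case: (F [::]).
    rewrite (_ : [set _ | _] = [set: T]) ?setIT; last by apply/seteqP; split.
    split; last by rewrite mule1 indepZ.
    by apply: bigcap_measurableType => j _; exact: mZp.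
  rewrite (_ : [set _ | false] = set0 :> set T) ?setI0; last by rewrite -subset0 => w.
  by rewrite measure0 mule0.
pose B' k j := if j == n then kappa @^-1` [set k] else B j.
have mB' k j : measurable (B' k j) by rewrite /B'; case: ifP.
pose C k := \bigcap_(j in `I_n.+1) (Z j @^-1` B' k j) `&`
  [set w | F (k :: labels n.+1 M w)].
have -> : \bigcap_(j in `I_n) (Z j @^-1` B j) `&` [set w | F (labels n M.+1 w)] =
    \bigcup_(k in [set: K]) C k.
  apply/seteqP; split=> [w [Bw Fw]|w [k _ [Bw Fw]]].
    exists (kappa (Z n w)) => //; split => // j /= jn; rewrite /B'.
    by case: eqP => [->//|/eqP jn']; apply: Bw; rewrite /= ltn_neqAle jn' -ltnS.
  split=> [j /= jn|].
    by have := Bw j (ltnW jn); rewrite /B' ltn_eqF.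
  have /= := Bw n (ltnSn n); rewrite /B' eqxx /= => kn.
  by move: Fw; rewrite /labels /= kn.
have PC k := IH n.+1 (B' k) (fun s => F (k :: s)) (mB' k).
split; first by apply: fin_bigcup_measurable => [|k _]; [exact: finite_finset|have [] := PC k].
rewrite measure_fin_bigcup; first last.
- by move=> k _; have [] := PC k.
- apply/trivIsetP => i j _ _ /eqP ij; rewrite -subset0 => w /= [[Bi _] [Bj _]].
  have /= := Bi n (ltnSn n); have /= := Bj n (ltnSn n).
  by rewrite /B' eqxx /= => -> /esym.
- exact: finite_finset.
rewrite fsbigT_finType.
(* Distributing the product over the sum of extended reals requires it to be finite, which holds as
   it is a probability. *)
have fB : (\prod_(j < n) P (Z j @^-1` B j))%E \is a fin_num.
  rewrite -indepZ //; apply: fin_num_measure.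
  by apply: bigcap_measurableType => j _; exact: mZp.
rewrite -(fineK fB) [iexp _ _ _]/= -sumEFin.
rewrite ge0_sume_distrr; last first.
  move=> k _; rewrite lee_fin mulr_ge0 ?law_ge0 //.
  rewrite -(iexp_cst sum_law M 0); apply: (ler_iexp law_ge0) => s _; exact: ler0n.
apply: eq_bigr => k _; have [_ PCk] := PC k; rewrite [LHS]PCk.
rewrite big_ord_recr /= {2}/B' eqxx lawE EFinM muleA; congr (_ * _ * _)%E.
rewrite fineK //; apply: eq_bigr => j _; by rewrite /B' ltn_eqF.
Qed.

Lemma measurable_labels M (F : pred (seq K)) :
  measurable [set w | F [seq kappa (Z i w) | i <- iota 0 M]].
Proof.
have [] := prob_cyl_labels M 0 F (fun=> measurableT).
by rewrite (_ : \bigcap_(_ in _) _ = setT) ?setTI // -subTset.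
Qed.

Lemma prob_labels M (F : pred (seq K)) :
  P [set w | F [seq kappa (Z i w) | i <- iota 0 M]] =
  (iexp law M (fun s => (F s)%:R))%:E.
Proof.
have [_] := prob_cyl_labels M 0 F (fun=> measurableT).
by rewrite (_ : \bigcap_(_ in _) _ = setT) ?setTI ?big_ord0 ?mul1e // -subTset.
Qed.

End LabelLaw.

(** * Measurability and boxes *)

Section Measurability.
Context {R : realType} {d : nat}.
Notation vec := 'rV[R]_d.
Notation Rd := (Rd R d).

Lemma measurable_coord (i : 'I_d) :
  measurable_fun [set: Rd] ((fun x : vec => x ord0 i) : Rd -> R).
Proof.
move=> mD; apply: (measurability _ (RGenOpens.measurableE R)) => //.
move=> _ [_ [p [q ->]] <-]; rewrite setTI; apply: sub_sigma_algebra.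
by apply: open_comp => [x _|]; [exact: coord_continuous|exact: interval_open].
Qed.

(** Half open, so that the cells partition a box and that points of successive boxes are strictly
    ordered in every coordinate. *)
Definition inbox (a b x : vec) : bool := [forall i, a ord0 i <= x ord0 i < b ord0 i].

Section Events.
Context {dT : measure_display} {T : measurableType dT}.

Lemma measurable_pred_forall (I : finType) (G : I -> T -> bool) :
  (forall i, measurable [set w | G i w]) -> measurable [set w | [forall i, G i w]].
Proof.
move=> mG; have -> : [set w | [forall i, G i w]] = \bigcap_(i in [set: I]) [set w | G i w].
  by apply/seteqP; split=> w /= Gw; [move=> i _; exact: (forallP Gw)|apply/forallP => i; exact: Gw].
by apply: fin_bigcap_measurable => // i _; exact: mG.
Qed.

Lemma measurable_pred_cst (b : bool) : measurable [set w : T | b].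
Proof.
case: b; first by rewrite (_ : [set _ | _] = setT) // -subTset.
by rewrite (_ : [set _ | _] = set0) // -subset0.
Qed.

Lemma measurable_pred_imply (b : bool) (g : T -> bool) :
  measurable [set w | g w] -> measurable [set w | b ==> g w].
Proof. by case: b => //= _; exact: measurable_pred_cst. Qed.

Lemma measurable_pred_and (f g : T -> bool) :
  measurable [set w | f w] -> measurable [set w | g w] ->
  measurable [set w | f w && g w].
Proof.
move=> mf mg; have -> : [set w | f w && g w] = [set w | f w] `&` [set w | g w].
  by apply/seteqP; split=> w /= /andP.
exact: measurableI.
Qed.

Lemma measurable_pred_neg (f : T -> bool) :
  measurable [set w | f w] -> measurable [set w | ~~ f w].
Proof.
move=> mf; have -> : [set w | ~~ f w] = ~` [set w | f w].
  by apply/seteqP; split=> w /= /negP.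
exact: measurableC.
Qed.

Lemma measurable_pred_or (f g : T -> bool) :
  measurable [set w | f w] -> measurable [set w | g w] ->
  measurable [set w | f w || g w].
Proof.
move=> mf mg; have -> : [set w | f w || g w] = [set w | f w] `|` [set w | g w].
  by apply/seteqP; split=> w /= /orP.
exact: measurableU.
Qed.

Lemma measurable_pred_le (f g : T -> R) :
  measurable_fun [set: T] f -> measurable_fun [set: T] g ->
  measurable [set w | f w <= g w].
Proof.
move=> mf mg; rewrite -[X in measurable X]setTI.
by apply: (measurable_fun_ler mf mg) => //; exact: (@measurableT _ bool).
Qed.

Lemma measurable_pred_lt (f g : T -> R) :
  measurable_fun [set: T] f -> measurable_fun [set: T] g ->
  measurable [set w | f w < g w].
Proof.
move=> mf mg; under eq_set do rewrite ltNge.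
exact/measurable_pred_neg/measurable_pred_le.
Qed.

Lemma measurable_coord_comp (Z : T -> Rd) (i : 'I_d) : measurable_fun [set: T] Z ->
  measurable_fun [set: T] (fun w => (Z w : vec) ord0 i).
Proof. by move=> mZ; exact: (measurableT_comp (measurable_coord i) mZ). Qed.

Lemma measurable_lev (Z Z' : T -> Rd) : measurable_fun [set: T] Z ->
  measurable_fun [set: T] Z' -> measurable [set w | lev (Z w : vec) (Z' w)].
Proof.
move=> mZ mZ'; apply: measurable_pred_forall => i.
by apply: measurable_pred_le; exact: measurable_coord_comp.
Qed.

Lemma measurable_inbox_comp (Z : T -> Rd) (a b : vec) : measurable_fun [set: T] Z ->
  measurable [set w | inbox a b (Z w)].
Proof.
move=> mZ; apply: measurable_pred_forall => i; apply: measurable_pred_and.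
  by apply: measurable_pred_le => //; exact: measurable_coord_comp.
by apply: measurable_pred_lt => //; exact: measurable_coord_comp.
Qed.

Lemma lev_eq (x y : vec) : (x == y) = lev x y && lev y x.
Proof.
apply/eqP/andP => [->|[/forallP xy /forallP yx]]; first by split; apply/forallP.
by apply/rowP => i; apply/le_anti; rewrite xy yx.
Qed.

(** The event is a finite intersection over index sets [S]: either [S] is not a chain or its size is
    below [y]. Positivity of [y] covers the neutral value 0 of the maximum. *)
Lemma measurable_chain_len_lt (Z : nat -> T -> vec) n (A : pred vec) (y : R) :
  (forall i, measurable_fun [set: T] (Z i : T -> Rd)) ->
  (forall i, measurable [set w | A (Z i w)]) -> 0 < y ->
  measurable [set w | (chain_len Z n A w)%:R < y].
Proof.
move=> mZ mA y0.
rewrite (_ : [set w | _] = [set w | [forall S : {set 'I_n},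
   ([forall i in S, A (Z i w)] &&
    [forall i in S, forall j in S,
       [&& lev (Z i w) (Z j w) || lev (Z j w) (Z i w)
         & (Z i w == Z j w) ==> (i == j)]]) ==> (#|S|%:R < y)]]); last first.
  apply/seteqP; split=> w /=.
    move=> H; apply/forallP => S; apply/implyP => HS; apply: le_lt_trans H.
    by rewrite ler_nat /chain_len (bigD1 S) //= leq_maxl.
  move=> /forallP H; rewrite /chain_len; elim/big_ind: _ => //.
    by move=> a b ay bY; rewrite /maxn; case: ifP.
  by move=> S HS; have /implyP := H S; apply.
apply: measurable_pred_forall => S; under eq_set do rewrite implybE.
apply: measurable_pred_or; last exact: measurable_pred_cst.
apply: measurable_pred_neg; apply: measurable_pred_and.
  by apply: measurable_pred_forall => i; exact: measurable_pred_imply.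
apply: measurable_pred_forall => i; apply: measurable_pred_imply.
apply: measurable_pred_forall => j; apply: measurable_pred_imply.
apply: measurable_pred_and.
  by apply: measurable_pred_or; exact: measurable_lev.
under eq_set do rewrite implybE lev_eq.
apply: measurable_pred_or; last exact: measurable_pred_cst.
by apply: measurable_pred_neg; apply: measurable_pred_and; exact: measurable_lev.
Qed.

End Events.
End Measurability.

(** The integral of a nonnegative function is a supremum over simple functions below it, hence
    monotone without measurability. It serves the partial integrals in [iint] and the integrand
    along a curve. *)
Lemma ge0_le_integral_nonmeas d (T : measurableType d) (R : realType)
    (mu : {measure set T -> \bar R}) (D : set T) (g h : T -> \bar R) :
  (forall t, D t -> 0 <= g t)%E -> (forall t, D t -> g t <= h t)%E ->
  (\int[mu]_(t in D) g t <= \int[mu]_(t in D) h t)%E.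
Proof.
move=> g0 gh; have h0 t : D t -> (0 <= h t)%E by move=> Dt; exact: le_trans (g0 t Dt) (gh t Dt).
rewrite !ge0_integralE //; apply: ereal_sup_le => _ [s /= sg <-].
exists s => //= t; apply: le_trans (sg t) _.
by rewrite /patch; case: ifPn => // /set_mem; exact: gh.
Qed.

(** * Iterated integrals of box indicators *)

Section BoxIntegral.
Context {R : realType} {d : nat}.
Notation vec := 'rV[R]_d.

Lemma iint_ge0 k (g : vec -> \bar R) x : (forall y, 0 <= g y)%E -> (0 <= iint k g x)%E.
Proof. by move=> g0; elim: k x => [|k IH] x //=; exact: integral_ge0. Qed.

Lemma le_iint k (g h : vec -> \bar R) x : (forall y, 0 <= g y)%E ->
  (forall y, g y <= h y)%E -> (iint k g x <= iint k h x)%E.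
Proof.
move=> g0 gh; elim: k x => [|k IH] x //=.
by apply: ge0_le_integral_nonmeas => t _; [exact: iint_ge0|exact: IH].
Qed.

(** After [k] integrations the first [k] coordinates have turned into side lengths, while the others
    still constrain [x]; the next integration moves coordinate [k] from the second group to the
    first. *)
Lemma iint_box k (a b : vec) (v : R) (x : vec) : (k <= d)%N -> 0 <= v ->
  (forall i, a ord0 i <= b ord0 i) ->
  iint k (fun y => (v * (inbox a b y)%:R)%:E) x =
  (v * \prod_(i < d | (i < k)%N) (b ord0 i - a ord0 i) *
     [forall i : 'I_d, (k <= i)%N ==> (a ord0 i <= x ord0 i < b ord0 i)]%:R)%:E.
Proof.
move=> kd v0 ab; elim: k kd x => [|k IH] kd x /=.
  rewrite big_pred0 // mulr1; congr (_ * _)%:E; congr (nat_of_bool _)%:R.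
pose ik := Ordinal kd.
pose rest := [forall i : 'I_d, (k < i)%N ==> (a ord0 i <= x ord0 i < b ord0 i)].
pose c := v * \prod_(i < d | (i < k)%N) (b ord0 i - a ord0 i) * rest%:R.
have c0 : 0 <= c.
  by rewrite !mulr_ge0 // prodr_ge0 // => i _; rewrite subr_ge0.
transitivity (\int[lebesgue_measure]_(t in [set: R])
    (c%:E * (\1_(`[a ord0 ik, b ord0 ik[%classic) t)%:E))%E.
  apply: eq_integral => t _; rewrite (IH (ltnW kd)) -EFinM /c; congr _%:E.
  rewrite -[RHS]mulrA; congr (_ * _); rewrite indicE -natrM mulnb.
  congr (nat_of_bool _)%:R.
  apply/forallP/andP => [H|[/forallP H tab] i].
    split; last first.
      have := H ik; rewrite leqnn /= mxE eqxx.
      by rewrite inE /= in_itv /=.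
    apply/forallP => i; apply/implyP => ki; have := H i.
    by rewrite (ltnW ki) /= mxE gtn_eqF.
  apply/implyP; rewrite leq_eqVlt => /orP[/eqP ki|ki].
    have -> : i = ik by apply/val_inj.
    by rewrite mxE eqxx; move: tab; rewrite inE /= in_itv.
  by rewrite mxE gtn_eqF //; have := H i; rewrite ki.
rewrite ge0_integralZl_EFin //; last first.
  by apply/measurable_EFinP; apply: measurable_indic.
have -> : (\int[lebesgue_measure]_(t in [set: R])
    (\1_(`[a ord0 ik, b ord0 ik[%classic) t)%:E = (b ord0 ik - a ord0 ik)%:E)%E.
  rewrite integral_indic // setIT; apply: etrans (lebesgue_measure_itv _) _ => /=.
  rewrite lte_fin; case: ltP => [_|ba]; first by rewrite EFinB.
  by rewrite (le_anti (introT andP (conj ba (ab ik)))) subrr.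
rewrite -EFinM /c; congr _%:E.
rewrite [in RHS](bigD1 ik) //=.
rewrite [in RHS](eq_bigl (fun i : 'I_d => (i < k)%N)); last first.
  by move=> i; rewrite -val_eqE /= ltnS andbC -ltn_neqAle.
by rewrite /rest; ring.
Qed.

Lemma intRd_box (a b : vec) (v : R) : 0 <= v -> (forall i, a ord0 i <= b ord0 i) ->
  intRd (fun y => (v * (inbox a b y)%:R)%:E) =
  (v * \prod_(i < d) (b ord0 i - a ord0 i))%:E.
Proof.
move=> v0 ab; rewrite /intRd iint_box //; congr _%:E.
rewrite (_ : [forall i, _] = true) ?mulr1; last first.
  by apply/forallP => i; rewrite leqNgt ltn_ord.
by congr (_ * _); apply: eq_bigl => i; rewrite ltn_ord.
Qed.

End BoxIntegral.

(** * Cells *)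

Lemma pairwise_sym_in (K : eqType) (e : rel K) (s : seq K) x y : symmetric e ->
  pairwise e s -> x \in s -> y \in s -> x != y -> e x y.
Proof.
move=> es; elim: s => [//|z s IH] /= /andP[/allP zs ps].
rewrite !inE => /predU1P[->|xs] /predU1P[->|ys]; rewrite ?eqxx // => xy.
- exact: zs.
- by rewrite es; exact: zs.
- exact: IH.
Qed.

Lemma uniq_pairwise (K : eqType) (e : rel K) (s : seq K) : uniq s ->
  (forall x y, x \in s -> y \in s -> x != y -> e x y) -> pairwise e s.
Proof.
elim: s => [//|z s IH] /= /andP[zs us] H; apply/andP; split.
  apply/allP => y ys; apply: H; rewrite ?inE ?eqxx ?ys ?orbT //.
  by apply: contraNneq zs => ->.
by apply: IH => // x y xs ys; apply: H; rewrite inE ?xs ?ys orbT.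
Qed.

Section ChainLen.
Context {R : realType} {d : nat} {T : Type}.
Notation vec := 'rV[R]_d.
Variables (X : nat -> T -> vec) (n : nat) (A : pred vec) (w : T).

Definition is_chain (S : {set 'I_n}) : bool :=
  [forall i in S, A (X i w)] &&
  [forall i in S, forall j in S,
     [&& lev (X i w) (X j w) || lev (X j w) (X i w) & (X i w == X j w) ==> (i == j)]].

Lemma chain_len_ge (S : {set 'I_n}) : is_chain S -> (#|S| <= chain_len X n A w)%N.
Proof. by move=> HS; rewrite /chain_len (bigD1 S) //= leq_maxl. Qed.

Lemma chain_len_witness : exists2 S, is_chain S & chain_len X n A w = #|S|.
Proof.
have [|S HS E] := @eq_bigmax_cond _ [pred S | is_chain S] (fun S => #|S|).
  apply/card_gt0P; exists finset.set0; rewrite inE /is_chain; apply/andP.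
  by split; apply/forallP => i; rewrite finset.in_set0.
by exists S.
Qed.

End ChainLen.

Section Cells.
Context {R : realType} {d : nat}.
Notation vec := 'rV[R]_d.
Variables (a b : vec) (m : nat).
Notation label := (option {ffun 'I_d -> 'I_m}).
Hypothesis ab : forall i, a ord0 i < b ord0 i.
Hypothesis m0 : (0 < m)%N.

Definition cell_lo (c : {ffun 'I_d -> 'I_m}) : vec :=
  \row_i (a ord0 i + (c i)%:R * ((b ord0 i - a ord0 i) / m%:R)).
Definition cell_hi (c : {ffun 'I_d -> 'I_m}) : vec :=
  \row_i (a ord0 i + (c i).+1%:R * ((b ord0 i - a ord0 i) / m%:R)).
Definition cell (x : vec) : label := [pick c | inbox (cell_lo c) (cell_hi c) x].

(** Coordinates measured from the corner in units of the cell side, so that for a point of the box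
    the cell index is the integer part. *)
Let pos (x : vec) i : R := (x ord0 i - a ord0 i) / ((b ord0 i - a ord0 i) / m%:R).

Let h0 i : 0 < (b ord0 i - a ord0 i) / m%:R.
Proof. by rewrite divr_gt0 ?subr_gt0 ?ltr0n. Qed.

Let ltr_pos x y i : (pos x i < pos y i) = (x ord0 i < y ord0 i).
Proof. by rewrite /pos ltr_pM2r ?invr_gt0 ?h0 // ltrD2r. Qed.

Let in_cellE x c : inbox (cell_lo c) (cell_hi c) x =
  [forall i, (c i)%:R <= pos x i < (c i).+1%:R].
Proof.
by apply: eq_forallb => i; rewrite !mxE ler_pdivlMr ?h0 // ltr_pdivrMr ?h0 // lerBrDl ltrBlDl.
Qed.

Let cell_pos x c : cell x = Some c -> forall i, (c i)%:R <= pos x i < (c i).+1%:R.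
Proof.
by rewrite /cell; case: pickP => // c' + [<-]; rewrite in_cellE => /forallP.
Qed.

Let pos_le_nat (k l : nat) (y y' : R) : k%:R <= y -> y <= y' -> y' < l.+1%:R -> (k <= l)%N.
Proof. by move=> ky yy yl; rewrite -ltnS -(ltr_nat R) (le_lt_trans (le_trans ky yy)). Qed.

(** Cells are disjoint: two indices whose cells contain [x] bracket the same [pos x i] between
    consecutive integers, so the choice made by [pick] is forced. *)
Lemma cell_SomeE x c : (cell x == Some c) = inbox (cell_lo c) (cell_hi c) x.
Proof.
apply/eqP/idP => [/cell_pos H|]; first by rewrite in_cellE; apply/forallP.
rewrite /cell in_cellE => /forallP H; case: pickP => [c'|/(_ c)]; last first.
  by rewrite in_cellE => /forallP.
rewrite in_cellE => /forallP H'; congr Some; apply/ffunP => i; apply/val_inj/anti_leq.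
have /andP[l1 r1] := H i; have /andP[l2 r2] := H' i.
by rewrite (pos_le_nat l1 (lexx _) r2) (pos_le_nat l2 (lexx _) r1).
Qed.

Lemma cell_inbox x : cell x -> inbox a b x.
Proof.
case E: (cell x) => [c|] // _; apply/forallP => i; have /andP[l1 r1] := cell_pos E i.
have p0 : 0 <= pos x i by apply: le_trans l1.
have pm : pos x i < m%:R by apply: lt_le_trans r1 _; rewrite ler_nat.
move: p0 pm; rewrite /pos.
rewrite pmulr_lge0 ?invr_gt0 ?h0 // subr_ge0 => ->.
rewrite ltr_pdivrMr ?h0 // mulrCA divff ?mulr1 ?lt0r_neq0 ?ltr0n //.
by rewrite ltrD2r.
Qed.

Definition cell_lt (k k' : label) : bool :=
  if k is Some c then if k' is Some c' then [forall i, (c i < c' i)%N] else false else false.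
Definition cell_cmp (k k' : label) : bool := cell_lt k k' || cell_lt k' k.
(** A point outside the box counts as tied with every label, so that the absence of ties also puts
    all points inside the box. *)
Definition cell_tie (k k' : label) : bool :=
  if k is Some c then if k' is Some c' then [exists i, c i == c' i] else true else true.
Definition cell_chain (s : seq label) : bool := all isSome s && pairwise cell_cmp s.

Lemma cell_lt_coord x y : cell_lt (cell x) (cell y) -> forall i, x ord0 i < y ord0 i.
Proof.
case Ex: (cell x) => [c|] //; case Ey: (cell y) => [c'|] //= /forallP cc i.
have /andP[_ r1] := cell_pos Ex i; have /andP[l2 _] := cell_pos Ey i.
by rewrite -ltr_pos (lt_le_trans r1) // (le_trans _ l2) // ler_nat.
Qed.

Lemma lev_cell_lt x y : lev x y -> ~~ cell_tie (cell x) (cell y) -> cell_lt (cell x) (cell y).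
Proof.
move=> /forallP xy; case Ex: (cell x) => [c|] //; case Ey: (cell y) => [c'|] //=.
rewrite negb_exists => /forallP ne; apply/forallP => i.
have /andP[l1 _] := cell_pos Ex i; have /andP[_ r2] := cell_pos Ey i.
rewrite ltn_neqAle val_eqE ne /=; apply: pos_le_nat l1 _ r2.
by rewrite leNgt ltr_pos -leNgt.
Qed.

Lemma cell_cmp_sym : symmetric cell_cmp.
Proof. by move=> k k'; rewrite /cell_cmp orbC. Qed.

Lemma cell_tie_sym : symmetric cell_tie.
Proof.
by move=> [c|] [c'|] //=; apply/existsP/existsP => -[i]; rewrite eq_sym => ?; exists i.
Qed.

Section Labels.
Context {T : Type}.
Variables (X : nat -> T -> vec) (w : T).
Definition cells n := [seq cell (X i w) | i <- iota 0 n].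

Let cellsE n : cells n = [seq cell (X (i : 'I_n) w) | i <- enum 'I_n].
Proof. by rewrite /cells -val_enum_ord -map_comp. Qed.

Hypothesis d0 : (0 < d)%N.

(** Labels strictly ordered in all coordinates order the points themselves, wherever these lie in
    their cells, so a chain of labels lifts to a chain of points. *)
Lemma cell_chain_len_ge n t : subseq t (cells n) -> cell_chain t ->
  (size t <= chain_len X n (inbox a b) w)%N.
Proof.
rewrite cellsE => /subseqP[bs _ ->]; rewrite -map_mask; set I := mask bs _.
have uI : uniq I by rewrite mask_uniq ?enum_uniq.
rewrite /cell_chain all_map pairwise_map size_map => /andP[/allP sI pI].
rewrite -(card_uniqP uI) -cardsE; apply: chain_len_ge; apply/andP; split.
  by apply/forallP => i; apply/implyP; rewrite inE => /sI; exact: cell_inbox.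
apply/forallP => i; apply/implyP; rewrite inE => iI.
apply/forallP => j; apply/implyP; rewrite inE => jI.
have [->|ij] := eqVneq i j; first by rewrite eqxx implybT andbT; apply/orP; left; apply/forallP.
have : cell_cmp (cell (X i w)) (cell (X j w)).
  apply: (@pairwise_sym_in _ (relpre (fun k : 'I_n => cell (X k w)) cell_cmp) I) => //.
  by move=> k l; exact: cell_cmp_sym.
have ne (x y : vec) : (forall k, x ord0 k < y ord0 k) -> lev x y /\ (x == y) = false /\ (y == x) = false.
  move=> xy; split; first by apply/forallP => k; exact: ltW.
  have : x != y.
    by apply/eqP => E; have := xy (Ordinal d0); rewrite E ltxx.
  by move=> nxy; split; apply/negbTE; rewrite // eq_sym.
by move=> /orP[] /cell_lt_coord /ne [-> [E1 E2]]; rewrite ?E1 ?E2 ?orbT.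
Qed.

(** Converse of the lifting: without ties, comparable points have labels strictly comparable in
    every coordinate. *)
Lemma chain_len_cell M n : (1 < M)%N -> (n <= M)%N ->
  pairwise (fun k k' => ~~ cell_tie k k') (cells M) ->
  exists t, [/\ subseq t (cells n), cell_chain t & size t = chain_len X n (fun _ => true) w].
Proof.
move=> M1 nM; rewrite /cells pairwise_map => pM.
have notie i j : (i < M)%N -> (j < M)%N -> i != j -> ~~ cell_tie (cell (X i w)) (cell (X j w)).
  move=> iM jM; apply: (@pairwise_sym_in _
    (relpre (fun k => cell (X k w)) (fun k k' => ~~ cell_tie k k')) (iota 0 M)) => //.
  - by move=> k l /=; rewrite cell_tie_sym.
  - by rewrite mem_iota.
  - by rewrite mem_iota.
have [S /andP[_ /forallP HS] ->] := chain_len_witness X n (fun _ => true) w.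
(* Pairwise conditions say nothing about a lone label; [1 < M] provides a second index with which a
   [None] label would tie. *)
have sS (i : 'I_n) : cell (X i w).
  have [j jM ij] : exists2 j, (j < M)%N & val i != j.
    by case: (eqVneq (val i) 0%N) => [->|ne]; [exists 1%N|exists 0%N => //; apply: leq_trans M1].
  by have := notie _ _ (leq_trans (ltn_ord i) nM) jM ij; case: (cell (X i w)).
exists [seq cell (X (i : 'I_n) w) | i <- enum S]; split.
- by rewrite -/(cells n) cellsE map_subseq // enumT filter_subseq.
- rewrite /cell_chain all_map pairwise_map; apply/andP; split; first by apply/allP => i _; exact: sS.
  apply: uniq_pairwise (enum_uniq _) _ => i j; rewrite !mem_enum => iS jS ij.
  have /implyP/(_ iS)/forallP/(_ j)/implyP/(_ jS)/andP[/orP lij _] := HS i.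
  have iM := leq_trans (ltn_ord i) nM; have jM := leq_trans (ltn_ord j) nM.
  case: lij => l; apply/orP; [left|right]; apply: lev_cell_lt => //; apply: notie => //.
  by rewrite eq_sym.
- by rewrite size_map -cardE.
Qed.

End Labels.

Lemma measurable_inbox (a' b' : vec) : measurable ([set x | inbox a' b' x] : set (Rd R d)).
Proof. exact: (@measurable_inbox_comp _ _ _ _ id). Qed.

Lemma measurable_cell k : measurable (cell @^-1` [set k] : set (Rd R d)).
Proof.
have mS c : measurable (cell @^-1` [set Some c] : set (Rd R d)).
  rewrite (_ : _ @^-1` _ = [set x | inbox (cell_lo c) (cell_hi c) x]); first exact: measurable_inbox.
  by apply/seteqP; split=> x /=; rewrite -cell_SomeE => /eqP.
case: k => [c|]; first exact: mS.
rewrite (_ : _ @^-1` _ = ~` \bigcup_(c in [set: {ffun 'I_d -> 'I_m}]) (cell @^-1` [set Some c])).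
  by apply/measurableC/fin_bigcup_measurable => // c _.
apply/seteqP; split => x /=; first by move=> xN [c _] /=; rewrite xN.
by move=> H; case E: (cell x) => [c|] //; exfalso; apply: H; exists c.
Qed.

Lemma cell_vol c : \prod_(i < d) (cell_hi c ord0 i - cell_lo c ord0 i) =
  (\prod_(i < d) (b ord0 i - a ord0 i)) * (m%:R ^+ d)^-1.
Proof.
transitivity (\prod_(i < d) ((b ord0 i - a ord0 i) * (m%:R)^-1)).
  by apply: eq_bigr => i _; rewrite !mxE -natr1; ring.
by rewrite big_split /= prodr_const card_ord exprVn.
Qed.

Lemma cell_lo_le_hi c i : cell_lo c ord0 i <= cell_hi c ord0 i.
Proof. by rewrite !mxE lerD2l ler_wpM2r ?ler_nat ?(ltW (h0 i)). Qed.

Definition unif (k : label) : R := if k is Some c then (m%:R ^+ d)^-1 else 0.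

Lemma unif_ge0 k : 0 <= unif k.
Proof. by case: k => [c|] //=; rewrite invr_ge0 exprn_ge0. Qed.

Lemma sum_option (F : label -> R) : \sum_k F k = F None + \sum_c F (Some c).
Proof.
rewrite (bigD1 None) //=; congr (_ + _).
rewrite (reindex_omap Some id) /=; last by case.
by apply: eq_bigl => c; rewrite eqxx.
Qed.

Lemma sum_unif : \sum_k unif k = 1.
Proof.
rewrite sum_option /= add0r sumr_const card_ffun !card_ord.
by rewrite -[LHS]mulr_natl natrX divff // expf_neq0 // pnatr_eq0 -lt0n.
Qed.

(** Union bound over the coordinates: two uniform cells share a given coordinate with probability
    [1 / m]. *)
Lemma sum_unif_tie :
  \sum_k unif k * (\sum_k' unif k' * (cell_tie k k')%:R) <= d%:R / m%:R.
Proof.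
have dm0 : 0 <= d%:R / m%:R :> R by rewrite divr_ge0.
rewrite -[leRHS]mul1r -[X in _ <= X * _]sum_unif mulr_suml; apply: ler_sum => -[c|] _; last by rewrite /= !mul0r.
apply: ler_wpM2l; first exact: unif_ge0.
rewrite sum_option /= mul0r add0r.
(* The indicator of agreement in coordinate [i] is written as a product over all coordinates, so
   that the sum over cells factors into one-dimensional sums. *)
apply: (@le_trans _ _ (\sum_(c' : {ffun 'I_d -> 'I_m}) \sum_(i < d)
    (\prod_(l < d) (m%:R^-1 * (if l == i then (c i == c' l)%:R else 1))))).
  apply: ler_sum => c' _.
  under [leRHS]eq_bigr => i _.
    rewrite big_split /= prodr_const card_ord exprVn -big_mkcond big_pred1_eq.
    over.
  rewrite -mulr_sumr; apply: ler_wpM2l; first by rewrite invr_ge0 exprn_ge0.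
  case: existsP => [[i ci]|_]; last exact: sumr_ge0.
  by rewrite (bigD1 i) //= ci lerDl sumr_ge0.
rewrite exchange_big /= (_ : d%:R / m%:R = \sum_(i < d) m%:R^-1); last first.
  by rewrite sumr_const card_ord mulr_natl.
apply: ler_sum => i _.
rewrite -(bigA_distr_bigA (fun l (j : 'I_m) => m%:R^-1 * (if l == i then (c i == j)%:R else 1))) /=.
have mm : m%:R * m%:R^-1 = 1 :> R by rewrite divff // pnatr_eq0 -lt0n.
rewrite (bigD1 i) //= [X in _ * X]big1 ?mulr1; last first.
  move=> l /negbTE -> ; under eq_bigr do rewrite mulr1.
  by rewrite sumr_const card_ord -[LHS]mulr_natl mm.
rewrite -mulr_sumr eqxx (bigD1 (c i)) //= eqxx big1 ?addr0 ?mulr1 //.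
by move=> j; rewrite eq_sym => /negbTE ->.
Qed.

End Cells.

(** * Uniform samples *)

Section IidDensity.
Context {R : realType} {d : nat}.
Notation vec := 'rV[R]_d.
Context {dT : measure_display} {T : measurableType dT} (P : probability T R)
  (X : nat -> T -> vec) (f : vec -> R).
Hypothesis iidX : iid_density P X f.

Lemma indic_inbox (a b x : vec) : \1_([set y | inbox a b y] : set (Rd R d)) x = (inbox a b x)%:R :> R.
Proof.
by rewrite indicE; congr (nat_of_bool _)%:R; apply/idP/idP => [/set_mem|H]; last exact: mem_set.
Qed.

Lemma iid_measurable i : measurable_fun [set: T] (X i : T -> Rd R d).
Proof. by case: iidX. Qed.

Lemma iid_same i (B : set (Rd R d)) : measurable B -> P (X i @^-1` B) = P (X 0%N @^-1` B).
Proof. by move=> mB; have [_ [H _]] := iidX; rewrite !H. Qed.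

Lemma iid_indep (n : nat) (B : nat -> set (Rd R d)) : (forall j, measurable (B j)) ->
  P (\bigcap_(j in `I_n) (X j @^-1` B j)) = (\prod_(j < n) P (X j @^-1` B j))%E.
Proof. by have [_ [_ H]] := iidX; exact: H. Qed.

Lemma iid_box_ge (a b : vec) (mu : R) : 0 <= mu -> (forall i, a ord0 i <= b ord0 i) ->
  (forall x, 0 <= f x) -> (forall x, inbox a b x -> mu <= f x) ->
  ((mu * \prod_(i < d) (b ord0 i - a ord0 i))%:E <= P (X 0%N @^-1` [set x | inbox a b x]))%E.
Proof.
move=> mu0 ab f0 fmu; have [_ [H _]] := iidX; rewrite H; last exact: measurable_inbox.
rewrite -intRd_box //; apply: le_iint => x; first by rewrite lee_fin mulr_ge0.
rewrite lee_fin indic_inbox.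
by case: (boolP (inbox a b x)) => [/fmu|_]; rewrite ?mulr1 ?mulr0.
Qed.

Lemma iid_box_eq (a b : vec) (mu : R) : 0 <= mu -> (forall i, a ord0 i <= b ord0 i) ->
  (forall x, inbox a b x -> f x = mu) ->
  P (X 0%N @^-1` [set x | inbox a b x]) = (mu * \prod_(i < d) (b ord0 i - a ord0 i))%:E.
Proof.
move=> mu0 ab fmu; have [_ [H _]] := iidX; rewrite H; last exact: measurable_inbox.
rewrite -intRd_box //; congr intRd; apply/funext => x.
rewrite indic_inbox; by case: (boolP (inbox a b x)) => [/fmu ->|_] //=; rewrite !mulr0.
Qed.

End IidDensity.

Definition unit_density {R : realType} {d : nat} (x : 'rV[R]_d) : R :=
  if [forall i, (0 <= x ord0 i <= 1)] then 1 else 0.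

Section UnitCube.
Context {R : realType} {d : nat}.
Notation vec := 'rV[R]_d.
Let one_vec : vec := \row_i 1.
Let ab01 i : (0 : vec) ord0 i < one_vec ord0 i.
Proof. by rewrite !mxE ltr01. Qed.
Context {dT : measure_display} {T : measurableType dT} (P : probability T R)
  (Y : nat -> T -> vec).
Hypothesis iidY : iid_density P Y unit_density.
Variable m : nat.
Hypothesis m0 : (0 < m)%N.

Lemma law_unit_cell k : law (S := Rd R d) P Y (cell 0 one_vec m) k = unif k.
Proof.
set l := law _ _ _.
have lS c : l (Some c) = unif (Some c).
  rewrite /l /law (_ : _ @^-1` [set Some c] = [set x | inbox (cell_lo 0 one_vec c) (cell_hi 0 one_vec c) x]).
    rewrite (iid_box_eq iidY (mu := 1)) //; last first.
    - move=> x; rewrite -cell_SomeE // => /eqP xc; rewrite /unit_density.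
      have /forallP xb : inbox 0 one_vec x by apply: (@cell_inbox _ _ _ _ m) => //; rewrite xc.
      rewrite (_ : [forall i, _]) //; apply/forallP => i; have := xb i.
      by rewrite !mxE => /andP[-> /ltW].
    - by move=> i; exact: cell_lo_le_hi.
    rewrite /= mul1r cell_vol big1 ?mul1r // => i _.
    by rewrite !mxE subr0.
  by apply/seteqP; split=> x /=; rewrite -cell_SomeE // => /eqP.
case: k => [c|]; first exact: lS.
(* The mass of [None] is determined by the other labels, as both laws have total mass 1. *)
have := sum_law (iid_measurable iidY) (iid_same iidY) (measurable_cell ab01 m0).
have := @sum_unif R d m m0; rewrite !sum_option /= add0r => su.
rewrite -/l => sl; apply: (@addIr _ (\sum_c l (Some c))); rewrite sl add0r -su.
by apply: eq_bigr => c _; rewrite lS.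
Qed.

(* Ties between cell labels have probability at most [M^2 d / m], and without
   ties the labels determine the order of the points. *)
Lemma iexp_unif_short_le (a r : R) N M : (0 < d)%N -> (1 < M)%N ->
  ((iexp (@unif R d m) M (fun s => (short (@cell_chain d m) a r N s)%:R))%:E <=
   P (\bigcup_(k in [set k | (N <= k)%N])
        [set w | ((chain_len Y k (fun _ => true) w)%:R < a * k%:R `^ r)%R])
   + (M%:R ^+ 2 * (d%:R / m%:R))%:E)%E.
Proof.
move=> d0 M1.
set D := \bigcup_(k in _) _.
(* For a threshold that is not positive the event is empty; otherwise the general measurability
   lemma applies. *)
have mk n : measurable [set w | (chain_len Y n (fun _ => true) w)%:R < a * n%:R `^ r].
  have [y0|y0] := ltP 0 (a * n%:R `^ r).
    apply: measurable_chain_len_lt => //; first exact: (iid_measurable iidY).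
    by move=> i; exact: measurable_pred_cst.
  rewrite (_ : [set _ | _] = set0) // -subset0 => w /=.
  by apply/negP; rewrite -leNgt (le_trans y0).
have mD : measurable D by apply: bigcup_measurable.
pose nt := fun s => pairwise (fun k k' => ~~ @cell_tie d m k k') s.
pose sh := short (@cell_chain d m) a r N.
(* Splits according to ties: tied sequences are paid for by the error term, and for the others short
   label chains mean short chains of points. *)
apply: (@le_trans _ _ (iexp (@unif R d m) M (fun s => (sh s && nt s)%:R + (~~ nt s)%:R))%:E).
  rewrite lee_fin; apply: ler_iexp => [k|s sM]; first exact: unif_ge0.
  by rewrite -/sh; case: (sh s); case: (nt s); rewrite /= ?addr0 ?add0r.
rewrite iexpD EFinD; apply: leeD; last first.
  rewrite lee_fin; apply: iexp_tie_le; [exact: unif_ge0|exact: sum_unif|exact: sum_unif_tie].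
rewrite (_ : @unif R d m = law (S := Rd R d) P Y (cell 0 one_vec m)); last first.
  by apply/funext => k; rewrite law_unit_cell.
rewrite -(prob_labels (iid_measurable iidY) (iid_same iidY) (iid_indep iidY)
   (measurable_cell ab01 m0) M (fun s => sh s && nt s)).
apply: le_measure; rewrite ?inE //.
  exact: (measurable_labels (iid_measurable iidY) (iid_same iidY) (iid_indep iidY)
   (measurable_cell ab01 m0) M (fun s => sh s && nt s)).
move=> w /= /andP[/asboolP[n [/andP[Nn nM] H]] nt_w].
rewrite size_map size_iota in nM.
exists n => //=; have [t' [ts' ct' E]] := chain_len_cell ab01 m0 M1 nM nt_w.
rewrite -E; apply: H => //; rewrite -map_take take_iota.
by rewrite (minn_idPl nM).
Qed.

End UnitCube.

(** Almost sure convergence to [c] makes the intersection of these decreasing tail events null, and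
    continuity from above makes their probabilities tend to 0. *)
Lemma uniform_tail (R : realType) (d : nat) (c theta : R) : @is_cd R d c -> 0 < theta < 1 ->
  exists (dT : measure_display) (T : measurableType dT) (P : probability T R)
         (Y : nat -> T -> 'rV[R]_d), iid_density P Y unit_density /\
    forall eps : R, 0 < eps -> exists N,
      (P (\bigcup_(k in [set k | (N <= k)%N])
        [set w | ((chain_len Y k (fun _ => true) w)%:R < theta * c * k%:R `^ (d%:R^-1))%R])
       <= eps%:E)%E.
Proof.
move=> [c0 [dT [T [P [Y [iidY cY]]]]]] /andP[t0 t1].
exists dT, T, P, Y; split => // eps eps0.
have tc0 : 0 < theta * c by rewrite mulr_gt0.
(* Starting at [maxn N 1] keeps the threshold positive, since [k = 0] would give a zero power. *)
pose D N := \bigcup_(k in [set k | (maxn N 1 <= k)%N])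
        [set w | (chain_len Y k (fun _ => true) w)%:R < theta * c * k%:R `^ (d%:R^-1)].
have mD N : measurable (D N).
  apply: bigcup_measurable => k /=; rewrite geq_max => /andP[_ k1]; apply: measurable_chain_len_lt.
  - exact: (iid_measurable iidY).
  - by move=> i; exact: measurable_pred_cst.
  - by rewrite mulr_gt0 // powR_gt0 // ltr0n.
have D_cvg : P \o D @ \oo --> P (\bigcap_n D n).
  apply: nonincreasing_cvg_mu => //.
  - by rewrite ltey_eq fin_num_measure.
  - exact: bigcap_measurable.
  - apply/nonincreasing_seqP => n; apply/subsetPset => w [k /= kN Hk]; exists k => //=.
    by apply: leq_trans kN; rewrite geq_max leq_max leqW //= leq_maxr.
have PD0 : P (\bigcap_n D n) = 0%E.
  apply: measure_negligible; first exact: bigcap_measurable.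
  apply: negligibleS cY => w /= wD cw.
  have /cvgrPdist_lt/(_ ((1 - theta) * c)) := cw.
  rewrite mulr_gt0 ?subr_gt0 // => /(_ isT)[N _ NH].
  have [k /= + +] := wD N I; rewrite geq_max => /andP[Nk k1].
  apply/negP; rewrite -leNgt.
  have := NH k Nk; rewrite /= distrC ltr_norml => /andP[+ _].
  have kr0 : 0 < k%:R `^ (d%:R^-1) :> R by rewrite powR_gt0 // ltr0n.
  rewrite powRN mulrC -(ltrD2r c) subrK => h; apply: ltW.
  rewrite -ltr_pdivlMr // [ltRHS]mulrC; apply: le_lt_trans h.
  by rewrite mulrBr mulr1 opprB subrK mulrC.
rewrite PD0 in D_cvg.
have /fine_cvgP[_ /cvgrPdist_lt/(_ _ eps0)[N _ NH]] := D_cvg.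
exists (maxn N 1); have := NH N (leqnn _); rewrite /= sub0r normrN.
rewrite -/(D N) => /(le_lt_trans (ler_norm _)) /ltW.
by rewrite -lee_fin fineK // fin_num_measure.
Qed.

(** Lets the number [m] of cells per side tend to infinity while the sample size stays fixed, which
    removes the tie probability. *)
Lemma ler_add_divn (R : realType) (x B C : R) :
  (forall m, (0 < m)%N -> x <= B + C / m%:R) -> x <= B.
Proof.
move=> H; apply/ler_addgt0Pr => e e0.
pose m := (Num.truncn (`|C| / e)).+1.
have m0 : 0 < m%:R :> R by rewrite ltr0n.
apply: le_trans (H m isT) _; rewrite lerD2l ler_pdivrMr //.
apply: le_trans (ler_norm _) _; rewrite -ler_pdivrMl // mulrC.
by apply/ltW/truncnS_gt; rewrite divr_ge0 // ltW.
Qed.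

(** * Longest chains in one box *)

Section BoxChains.
Context {R : realType} {d : nat}.
Notation vec := 'rV[R]_d.
Context {dT : measure_display} {T : measurableType dT} (P : probability T R)
  (X : nat -> T -> vec) (f : vec -> R).
Hypothesis iidX : iid_density P X f.
Variables (a b : vec) (mu : R).
Hypothesis d0 : (0 < d)%N.
Hypothesis ab : forall i, a ord0 i < b ord0 i.
Hypothesis mu0 : 0 < mu.
Hypothesis f0 : forall x, 0 <= f x.
Hypothesis fmu : forall x, inbox a b x -> mu <= f x.
Let p := mu * \prod_(i < d) (b ord0 i - a ord0 i).
Let r : R := d%:R^-1.

Lemma box_mass_gt0 : 0 < p.
Proof. by rewrite mulr_gt0 // prodr_gt0 // => i _; rewrite subr_gt0. Qed.

Lemma box_mass_le1 : p <= 1.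
Proof.
rewrite -lee_fin; apply: le_trans (iid_box_ge iidX (ltW mu0) _ f0 fmu) _.
  by move=> i; exact: ltW.
by apply: probability_le1; rewrite -[X in measurable X]setTI; apply: (iid_measurable iidX) => //;
  exact: measurable_inbox.
Qed.

(** Each of the [m ^ d] cells has volume [V / m ^ d] and density at least [mu]. This is the
    domination required by thinning. *)
Lemma unif_le_law m (m0 : (0 < m)%N) k :
  p * unif k <= law (S := Rd R d) P X (cell a b m) k.
Proof.
case: k => [c|]; last by rewrite /= mulr0 law_ge0.
rewrite -lee_fin -(lawE (iid_measurable iidX) (iid_same iidX) (measurable_cell ab m0) 0).
rewrite (_ : _ @^-1` [set Some c] = [set x | inbox (cell_lo a b c) (cell_hi a b c) x]); last first.
  by apply/seteqP; split=> x /=; rewrite -cell_SomeE // => /eqP.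
apply: le_trans (iid_box_ge iidX (ltW mu0) _ f0 _); last 2 first.
- by move=> i; exact: cell_lo_le_hi.
- move=> x; rewrite -cell_SomeE // => /eqP xc; apply: fmu.
  by apply: (@cell_inbox _ _ _ _ m) => //; rewrite xc.
by rewrite lee_fin cell_vol // /p mulrA.
Qed.

Variables (theta y : R).
Hypothesis theta01 : 0 < theta < 1.
Hypothesis y0 : 0 < y.

(** The cutoff [M] makes this an event of finitely many points, accessible through their labels; it
    is removed later by a bound uniform in [M]. *)
Definition bad_upto N M := \bigcup_(n in [set n | (N <= n <= M)%N])
  [set w | (chain_len X n (inbox a b) w)%:R < y * (theta * p) `^ r * n%:R `^ r].

Lemma measurable_bad_upto N M : (0 < N)%N -> measurable (bad_upto N M).
Proof.
move=> N0; apply: bigcup_measurable => n /= /andP[Nn _]; apply: measurable_chain_len_lt.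
- exact: (iid_measurable iidX).
- move=> i; exact: measurable_inbox_comp (iid_measurable iidX i).
- have [t0 _] := andP theta01; apply: mulr_gt0; last by apply: powR_gt0; rewrite ltr0n (leq_trans N0).
  by rewrite mulr_gt0 // powR_gt0 // mulr_gt0 // box_mass_gt0.
Qed.

(** One [eps] pays for too few kept labels (Chernoff), the other for short chains in the uniform
    sample. The third error, from ties, depends on [M] but vanishes as the grid is refined. *)
Lemma bad_upto_le (dS : measure_display) (S : measurableType dS)
    (Q : probability S R) (Y : nat -> S -> vec) (iidY : iid_density Q Y unit_density) N' (eps : R) :
  (Q (\bigcup_(k in [set k | (N' <= k)%N])
        [set w | ((chain_len Y k (fun _ => true) w)%:R < y * k%:R `^ r)%R])
       <= eps%:E)%E ->
  0 < eps -> exists N, (0 < N)%N /\ forall M, (1 < M)%N -> (P (bad_upto N M) <= (eps + eps)%:E)%E.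
Proof.
move=> Qeps eps0; have [t0 t1] := andP theta01.
have p01 : 0 < p <= 1 by rewrite box_mass_gt0 box_mass_le1.
have p01' : 0 <= p <= 1 by rewrite ltW ?box_mass_gt0 ?box_mass_le1.
have [rho /andP[rho0 rho1] few_le] := iexp_few_le p01 theta01.
have tp0 : 0 < theta * p by rewrite mulr_gt0 ?box_mass_gt0.
have r0 : 0 <= r by rewrite invr_ge0.
have : (fun N => rho ^+ N) @ \oo --> (0:R) by apply: cvg_expr; rewrite ger0_norm.
move=> /cvgrPdist_lt/(_ (eps * (1 - rho))).
rewrite mulr_gt0 ?subr_gt0 // => /(_ isT)[N1 _ N1H].
pose N2 := Num.truncn (N'%:R / (theta * p)).
(* [N1] makes the Chernoff tail at most [eps]; [N2] makes the guaranteed number [theta * p * N] of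
   kept labels at least [N']. *)
pose N := maxn N1 N2.+1.
have N0 : (0 < N)%N by rewrite leq_max orbT.
have NN' : N'%:R <= theta * p * N%:R.
  rewrite -ler_pdivrMl // mulrC.
  apply: le_trans (ltW (truncnS_gt _)) _; last by rewrite ler_nat leq_max leqnn orbT.
have rhoN : rho ^+ N / (1 - rho) <= eps.
  rewrite ler_pdivrMr ?subr_gt0 //; apply/ltW.
  have := N1H N (leq_maxl _ _); rewrite /= sub0r normrN.
  exact: le_lt_trans (ler_norm _).
exists N; split => // M M1.
have fE : P (bad_upto N M) \is a fin_num by apply/fin_num_measure/measurable_bad_upto.
rewrite -(fineK fE) lee_fin.
apply: (@ler_add_divn _ _ _ (M%:R ^+ 2 * d%:R)) => m m0.
pose F := short (@cell_chain d m) (y * (theta * p) `^ r) r N.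
pose F2 := short (@cell_chain d m) y r N'.
have mX := iid_measurable iidX; have sX := iid_same iidX; have iX := iid_indep iidX.
have mc := measurable_cell ab m0.
rewrite -lee_fin fineK //.
(* A chain of labels gives a chain of points in the box, so short chains of points force short
   chains of labels. *)
apply: (@le_trans _ _ (P [set w | F [seq cell a b m (X i w) | i <- iota 0 M]])).
  apply: le_measure; rewrite ?inE.
  - exact: measurable_bad_upto.
  - exact: (measurable_labels mX sX iX mc M F).
  move=> w [n /= /andP[Nn nM] Hn]; apply/asboolP; exists n.
  rewrite size_map size_iota Nn nM; split => // t.
  rewrite -map_take take_iota (minn_idPl nM) => ts ct.
  apply: le_lt_trans Hn; rewrite ler_nat.
  exact: (cell_chain_len_ge ab m0 d0 ts ct).
rewrite (prob_labels mX sX iX mc M F).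
have thin : iexp (law (S := Rd R d) P X (cell a b m)) M (fun s => (F s)%:R) <=
    iexp (bern p) M (fun bs => (few (theta * p) N bs)%:R) +
    iexp (@unif R d m) M (fun s => (F2 s)%:R).
  apply: iexp_thinning => //.
  - exact: law_ge0.
  - exact: (sum_law mX sX mc).
  - exact: unif_ge0.
  - exact: sum_unif.
  - exact: unif_le_law.
  - move=> s k; rewrite ler_nat; case E: (F2 s) => //.
    by rewrite /F2 short_rcons.
  - move=> bs s sb ss; rewrite -natrD ler_nat; case E: (F s) => //.
    have := @short_mask R _ _ y r (theta * p) N N' bs s (ltW y0) r0 (ltW tp0) NN' _ E.
    by rewrite sb ss -/(F2 _) => /(_ erefl) /orP[] ->; rewrite // addn1.
apply: (@le_trans _ _ ((iexp (bern p) M (fun bs => (few (theta * p) N bs)%:R))%:E +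
    (iexp (@unif R d m) M (fun s => (F2 s)%:R))%:E)%E); first by rewrite -EFinD lee_fin.
rewrite -addrA EFinD; apply: leeD.
  by rewrite lee_fin (le_trans (few_le N M)).
apply: (le_trans (iexp_unif_short_le iidY m0 y r N' d0 M1)).
by rewrite EFinD mulrA; apply: leeD.
Qed.

End BoxChains.

(** One factor [theta] is lost to the convergence defining [c], the other to thinning, which costs
    only [theta ^ (1 / d)]. *)
Theorem box_chain_ae (R : realType) (d : nat) (c : R) (dT : measure_display)
    (T : measurableType dT) (P : probability T R) (X : nat -> T -> 'rV[R]_d)
    (f : 'rV[R]_d -> R) (a b : 'rV[R]_d) (mu theta : R) :
  is_cd d c -> iid_density P X f -> (0 < d)%N -> (forall i, a ord0 i < b ord0 i) ->
  0 < mu -> (forall x, 0 <= f x) -> (forall x, inbox a b x -> mu <= f x) ->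
  0 < theta < 1 ->
  {ae P, forall w, \forall n \near \oo,
    theta ^+ 2 * c * (mu * \prod_(i < d) (b ord0 i - a ord0 i)) `^ (d%:R^-1) * n%:R `^ (d%:R^-1)
      <= (chain_len X n (inbox a b) w)%:R}.
Proof.
move=> cd iidX d0 ab mu0 f0 fmu t01; have [c0 _] := cd; have [t0 t1] := andP t01.
have [dS [S [Q [Y [iidY tailY]]]]] := uniform_tail cd t01.
have y0 : 0 < theta * c by rewrite mulr_gt0.
pose p := mu * \prod_(i < d) (b ord0 i - a ord0 i).
have p0 : 0 < p by apply: box_mass_gt0.
pose E N M := bad_upto X a b mu theta (theta * c) N M.
have mE N M : measurable (E N.+1 M) by apply: (measurable_bad_upto iidX).
(* The shifts [N.+1] and [M.+2] build in the side conditions [0 < N] and [1 < M] of the previous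
   bounds. *)
pose G N := \bigcup_M E N.+1 M.+2.
have mG N : measurable (G N) by apply: bigcupT_measurable.
have G0 : P (\bigcap_N G N) = 0%E.
  apply/eqP; rewrite eq_le measure_ge0 andbT; apply/lee_addgt0Pr => e e0.
  have e20 : 0 < e / 2 by rewrite divr_gt0.
  have [N' QN'] := tailY _ e20.
  have [N [N0 HN]] := bad_upto_le iidX d0 ab mu0 f0 fmu t01 y0 iidY QN' e20.
  rewrite add0e; case: N N0 HN => // N _ HN.
  apply: (@le_trans _ _ (P (G N))).
    by apply: le_measure; rewrite ?inE //; [exact: bigcap_measurable|exact: bigcap_inf].
  (* Continuity from below carries the bound, uniform in [M], over to [G N]. *)
  have cvgG : P \o (fun M => E N.+1 M.+2) @ \oo --> P (G N).
    apply: nondecreasing_cvg_mu => [M||M1 M2 M12]; [exact: mE|exact: mG|apply/subsetPset].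
    by move=> w [n /= /andP[Nn nM] Hn]; exists n => //=; rewrite Nn (leq_trans nM).
  rewrite -(cvg_lim _ cvgG) //; apply: lime_le; first by apply/cvg_ex; exists (P (G N)).
  apply: nearW => M /=; apply: le_trans (HN M.+2 isT) _.
  by rewrite -splitr.
exists (\bigcap_N G N); split => //; first exact: bigcap_measurable.
move=> w /= Hw N _; apply: contrapT => GN; apply: Hw.
exists N.+1 => // n /= Nn; rewrite leNgt; apply/negP => Hn; apply: GN.
exists n => //; exists n; first by rewrite /= Nn ltnW.
apply: lt_le_trans Hn _; rewrite ler_wpM2r ?powR_ge0 //.
rewrite -/p (powRM _ (ltW t0) (ltW p0)) mulrA ler_wpM2r ?powR_ge0 //.
rewrite expr2 -!mulrA ler_wpM2l ?(ltW t0) // mulrC ler_wpM2l ?(ltW c0) //.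
(* Since [theta < 1] and [1 / d <= 1], [theta] is at most its [d]-th root. *)
have -> : theta = theta `^ 1 by rewrite powRr1 // ltW.
rewrite -powRrM mul1r ger_powR ?t0 ?(ltW t1) //.
by rewrite invf_le1 ?ltr0n // ler1n.
Qed.

(** * Concatenation of chains *)

Section Concatenation.
Context {R : realType} {d : nat} {T : Type}.
Notation vec := 'rV[R]_d.
Variables (X : nat -> T -> vec) (n : nat) (w : T).

Lemma chain_len_sub (A B : pred vec) : (forall x, A x -> B x) ->
  (chain_len X n A w <= chain_len X n B w)%N.
Proof.
move=> AB; have [S /andP[/forallP SA Sc] ->] := chain_len_witness X n A w.
apply: chain_len_ge; apply/andP; split => //.
by apply/forallP => i; apply/implyP => iS; apply: AB; have /implyP := SA i; exact.
Qed.

(** The strict separation makes the two optimal index sets disjoint, and their union is again a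
    chain. *)
Lemma chain_len_cat (A B : pred vec) :
  (forall x y, A x -> B y -> lev x y && (x != y)) ->
  (chain_len X n A w + chain_len X n B w <= chain_len X n [predU A & B] w)%N.
Proof.
move=> AB.
have [S /andP[/forallP SA /forallP Sc] ->] := chain_len_witness X n A w.
have [S' /andP[/forallP SB /forallP Sc'] ->] := chain_len_witness X n B w.
have inA i : i \in S -> A (X i w) by have /implyP := SA i.
have inB i : i \in S' -> B (X i w) by have /implyP := SB i.
have dS : S :&: S' = finset.set0.
  apply/finset.setP => i; rewrite !finset.inE; apply/negbTE/negP => /andP[iS iS'].
  by have := AB _ _ (inA i iS) (inB i iS'); rewrite eqxx andbF.
rewrite -cardsUI dS cards0 addn0; apply: chain_len_ge; apply/andP; split.
  apply/forallP => i; apply/implyP; rewrite finset.inE => /orP[iS|iS]; apply/orP; [left|right].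
    exact: inA.
  exact: inB.
apply/forallP => i; apply/implyP; rewrite finset.inE => iS.
apply/forallP => j; apply/implyP; rewrite finset.inE => jS.
case/orP: iS => iS; case/orP: jS => jS.
- by have /implyP/(_ iS)/forallP/(_ j)/implyP/(_ jS) := Sc i.
- by have /andP[-> /negbTE->] := AB _ _ (inA i iS) (inB j jS).
- by have /andP[-> ne] := AB _ _ (inA j jS) (inB i iS); rewrite orbT eq_sym (negbTE ne).
- by have /implyP/(_ iS)/forallP/(_ j)/implyP/(_ jS) := Sc' i.
Qed.

Lemma sum_chain_len_le (a b : nat -> vec) (z : vec) J : (0 < d)%N ->
  (forall j j', (j < j' < J)%N -> lev (b j) (a j')) ->
  (forall j, (j < J)%N -> lev (b j) z) ->
  (\sum_(j < J) chain_len X n (inbox (a j) (b j)) w <= u_n X n z w)%N.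
Proof.
move=> d0 ba bz.
suff H K : (K <= J)%N -> (\sum_(j < K) chain_len X n (inbox (a j) (b j)) w <=
    chain_len X n (fun x => [exists j : 'I_K, inbox (a j) (b j) x]) w)%N.
  apply: leq_trans (H J (leqnn J)) _; apply: chain_len_sub => x /existsP[j /forallP xj].
  apply/forallP => i; have /andP[_ /ltW xb] := xj i.
  by apply: le_trans xb _; have /forallP := bz j (ltn_ord j); apply.
elim: K => [_|K IH KJ]; first by rewrite big_ord0.
rewrite big_ord_recr /=.
apply: leq_trans (leq_add (IH (ltnW KJ)) (leqnn _)) _.
apply: leq_trans (chain_len_cat _) _; last first.
  apply: chain_len_sub => x /orP[/existsP[j xj]|xK]; apply/existsP.
    by exists (widen_ord (leqnSn K) j).
  by exists ord_max.
move=> x y /existsP[j /forallP xj] /forallP yK.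
have xy i : x ord0 i < y ord0 i.
  have /andP[_ xb] := xj i; have /andP[ay _] := yK i.
  apply: lt_le_trans xb (le_trans _ ay).
  by have /forallP := ba j K (introT andP (conj (ltn_ord j) KJ)); apply.
apply/andP; split; first by apply/forallP => i; exact: ltW.
by apply/eqP => E; have := xy (Ordinal d0); rewrite E ltxx.
Qed.

End Concatenation.

(** * Lower limits and lower semicontinuity *)

Section Liminf.
Context {R : realType}.
Implicit Types (u : nat -> \bar R) (l : \bar R).

Lemma limn_einf_ge u l : (\forall n \near \oo, l <= u n)%E -> (l <= limn_einf u)%E.
Proof.
move=> [N _ H]; rewrite limn_einf_lim; apply: lime_ge; first exact: is_cvg_einfs.
exists N => // n Nn; apply: le_ereal_inf_tmp => _ [k /= nk <-].
by apply: H; exact: leq_trans nk.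
Qed.

Lemma limn_einf_le u l : (forall n, u n <= l)%E -> (limn_einf u <= l)%E.
Proof.
move=> H; rewrite limn_einf_lim; apply: lime_le; first exact: is_cvg_einfs.
by apply: nearW => n; apply: le_trans (H n); apply: ereal_inf_lbound; exists n => /=.
Qed.

Definition frac_succ (i : nat) : R := i.+1%:R / i.+2%:R.

Lemma frac_succ01 i : 0 < frac_succ i < 1.
Proof. by rewrite divr_gt0 ?ltr0n //= ltr_pdivrMr ?ltr0n // mul1r ltr_nat. Qed.

Lemma cvg_frac_succ : frac_succ @ \oo --> (1 : R).
Proof.
rewrite (_ : frac_succ = fun i => 1 - harmonic i.+1); last first.
  apply/funext => i; rewrite /frac_succ /harmonic /=.
  have -> : i.+1%:R = i.+2%:R - 1 :> R by rewrite -[i.+2]addn1 natrD addrK.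
  by rewrite mulrBl divff // mul1r.
rewrite -[X in _ --> X]subr0; apply: cvgB; first exact: cvg_cst.
by have := @cvg_harmonic R; rewrite -cvg_shiftS.
Qed.

(** Removes the multiplicative losses [theta ^ 2] and [kappa ^ (d + 1)] by letting the base run
    through a sequence increasing to 1. *)
Lemma lee_expr_lim (k : nat) (x : R) l :
  (forall i, ((frac_succ i ^+ k * x)%:E <= l)%E) -> (x%:E <= l)%E.
Proof.
have ck : {for 1, continuous (fun t : R => t ^+ k)} by exact: exprn_continuous.
have cvk : (fun i => frac_succ i ^+ k) @ \oo --> (1 : R).
  by rewrite -[X in _ --> X](expr1n R k); exact: continuous_cvg _ ck cvg_frac_succ.
have := cvgM cvk (cvg_cst x); rewrite mul1r => cvx.
move=> H; have cv : (fun i => (frac_succ i ^+ k * x)%:E) @ \oo --> x%:E.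
  by apply: cvg_EFin; [exact: nearW|exact: cvx].
rewrite -(cvg_lim _ cv) //; apply: lime_le; first by apply/cvg_ex; exists x%:E.
exact: nearW.
Qed.

End Liminf.

Section LowerSemicontinuity.
Context {R : realType} {d : nat}.
Notation vec := 'rV[R]_d.

Lemma eucl_continuous : continuous (@eucl R d).
Proof.
move=> x; apply: (@continuous_comp _ _ _ (fun x : vec => \sum_(i < d) x ord0 i ^+ 2)); last first.
  exact: sqrt_continuous.
move: x; apply: continuous_big => [|i _ x]; first exact: add_continuous.
apply: (@continuous_comp _ _ _ (fun x : vec => x ord0 i) (fun u : R => u ^+ 2)).
  exact: coord_continuous.
exact: exprn_continuous.
Qed.

(** Where [f] is positive the point lies in the open set [O], so nearby points do too, and there the
    modulus bounds the drop of [f] by [(1 - kappa) * f x]. *)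
Lemma modulus_lsc (O : set vec) (f : vec -> R) (m : R -> R) : open O ->
  {within `[0, +oo[, continuous m} -> m 0 = 0 ->
  (forall x y, O x -> O y -> `|f x - f y| <= m (eucl (x - y))) ->
  (forall x, ~ O x -> f x = 0) ->
  forall (x : vec) (kappa : R), 0 < kappa < 1 -> 0 < f x -> \forall y \near x, kappa * f x <= f y.
Proof.
move=> oO /continuous_within_itvcyP[_ cm] m0 fm fO x kappa /andP[k0 k1] fx0.
have Ox : O x by apply: contrapT => /fO fx; move: fx0; rewrite fx ltxx.
have e0 : 0 < (1 - kappa) * f x by rewrite mulr_gt0 // subr_gt0.
move: cm; rewrite m0 => /cvgrPdist_le/(_ _ e0) /nbhs_ballP[r /= r0 H].
have eu0 : eucl (0 : vec) = 0.
  rewrite /eucl big1 ?sqrtr0 // => i _; by rewrite mxE expr0n.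
have cx : {for x, continuous (fun y : vec => x - y)}.
  by apply: continuousB; [exact: cst_continuous|exact: cvg_id].
have : (fun y => eucl (x - y)) @ x --> eucl (x - x) := continuous_comp cx (@eucl_continuous (x - x)).
rewrite subrr eu0 => /cvgrPdist_lt/(_ _ r0) near_r.
(* The right limit of [m] at 0 concerns only [s > 0]; the value [m 0 = 0] settles [s = 0]. *)
have mle s : 0 <= s -> s < r -> m s <= (1 - kappa) * f x.
  rewrite le_eqVlt => /orP[/eqP <- _|s0 sr]; first by rewrite m0 ltW.
  have := H s; rewrite /ball /= sub0r normrN gtr0_norm // => /(_ sr s0).
  by rewrite sub0r normrN; exact: le_trans (ler_norm _).
near=> y; have Oy : O y by near: y; exact: open_nbhs_nbhs.
have er : eucl (x - y) < r.
  by apply: le_lt_trans (ler_norm _) _; rewrite -normrN -sub0r; near: y.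
have := le_trans (ler_norm _) (le_trans (fm x y Ox Oy) (mle _ (sqrtr_ge0 _) er)).
lra.
Unshelve. all: by end_near.
Qed.

End LowerSemicontinuity.

Lemma derivable_linear_approx (R : realType) (h : R -> R) (t eps : R) :
  derivable h t 1 -> 0 < eps ->
  \forall s \near t, `|h s - h t - (derive1 h t) * (s - t)| <= eps * `|s - t|.
Proof.
move=> dh e0; rewrite derive1E.
have /cvgrPdist_le/(_ _ e0) /nbhs_ballP[r /= r0 H] :
  (fun u => u^-1 *: (h (u *: 1 + t) - h t)) @ 0^' --> 'D_1 h t by exact: dh.
apply/nbhs_ballP; exists r => //= s; rewrite /ball /= distrC => sr.
have [->|st] := eqVneq s t; first by rewrite !subrr mulr0 subrr !normr0 mulr0.
have u0 : s - t != 0 by rewrite subr_eq0.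
have := H (s - t); rewrite /ball /= sub0r normrN => /(_ sr u0).
rewrite /GRing.scale /= mulr1 subrK.
rewrite -(ler_pM2r (x := `|s - t|)) ?normr_gt0 // -normrM mulrBl mulrAC mulVf // mul1r.
by rewrite distrC.
Qed.

(** * Lower sums along a curve *)

Section LowerSums.
Context {R : realType} {d : nat}.
Notation vec := 'rV[R]_d.
Variables (f : vec -> R) (gam : R -> vec).
Hypothesis d0 : (0 < d)%N.
Hypothesis f0 : forall x, 0 <= f x.
Hypothesis f_lsc : forall (x : vec) (kappa : R), 0 < kappa < 1 -> 0 < f x ->
  \forall y \near x, kappa * f x <= f y.
Hypothesis dgam : forall t : R, 0 <= t <= 1 -> derivable gam t 1.
Hypothesis dgam0 : forall t : R, 0 <= t <= 1 -> forall i, 0 <= (derive1 gam t) ord0 i.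
Let r : R := d%:R^-1.

Definition node (N j : nat) : vec := gam (j%:R / N.+1%:R).
(** The infimum of the empty set is 0 here. For a nondecreasing curve an empty box has a side of
    length 0, so its term in the lower sum is 0 anyway. *)
Definition floor_val (N j : nat) : R :=
  inf [set f x | x in [set x | inbox (node N j) (node N j.+1) x]].
Definition box_vol (N j : nat) : R :=
  \prod_(i < d) (node N j.+1 ord0 i - node N j ord0 i).
Definition lower_sum (N : nat) : R :=
  \sum_(j < N.+1) (floor_val N j * box_vol N j) `^ r.

(* The closed intervals overlap at grid points, where the sum only gets larger;
   they leave no point of [[0, 1]] uncovered. *)
Definition lower_step (N : nat) (t : R) : R :=
  \sum_(j < N.+1) (N.+1%:R * (floor_val N j * box_vol N j) `^ r) *
    \1_(`[j%:R / N.+1%:R, j.+1%:R / N.+1%:R]%classic) t.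

Lemma coord_derivable (t : R) i : 0 <= t <= 1 -> derivable (fun s => gam s ord0 i) t 1.
Proof. by move=> /dgam /derivable_mxP; exact. Qed.

Lemma coord_derive1 (t : R) i : 0 <= t <= 1 ->
  derive1 (fun s => gam s ord0 i) t = (derive1 gam t) ord0 i.
Proof. by move=> /dgam dg; rewrite !derive1E derive_mx // mxE. Qed.

Lemma coord_homo i (s t : R) : 0 <= s -> s <= t -> t <= 1 -> gam s ord0 i <= gam t ord0 i.
Proof.
move=> s0 st t1; have in01 (x : R) : x \in `]0, 1[ -> 0 <= x <= 1.
  by rewrite in_itv /= => /andP[/ltW-> /ltW->].
apply: (@ger0_derive1_ndecr _ (fun s => gam s ord0 i) 0 1) => //.
- by move=> x /in01; exact: coord_derivable.
- by move=> x /in01 x01; rewrite coord_derive1 // dgam0.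
- by apply: derivable_within_continuous => x; rewrite in_itv /=; exact: coord_derivable.
Qed.

Lemma frac01 (N j : nat) : (j <= N.+1)%N -> 0 <= (j%:R / N.+1%:R : R) <= 1.
Proof.
by move=> jN; rewrite divr_ge0 //= ler_pdivrMr ?ltr0n // mul1r ler_nat.
Qed.

Lemma node_homo N j k i : (j <= k)%N -> (k <= N.+1)%N -> node N j ord0 i <= node N k ord0 i.
Proof.
move=> jk kN; have /andP[? _] := frac01 (leq_trans jk kN); have /andP[_ ?] := frac01 kN.
by apply: coord_homo => //; rewrite ler_pM2r ?invr_gt0 ?ltr0n // ler_nat.
Qed.

Lemma box_vol_ge0 N j : (j < N.+1)%N -> 0 <= box_vol N j.
Proof. by move=> jN; apply: prodr_ge0 => i _; rewrite subr_ge0 node_homo. Qed.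

Lemma floor_val_ge0 N j : 0 <= floor_val N j.
Proof.
rewrite /floor_val; set E := [set _ | _ in _].
have [->|/set0P E0] := eqVneq E set0; first by rewrite inf0.
by apply: lb_le_inf => // _ [x _ <-].
Qed.

Lemma floor_val_le N j x : inbox (node N j) (node N j.+1) x -> floor_val N j <= f x.
Proof.
by move=> xb; apply: ge_inf; [exists 0 => _ [y _ <-]|exists x].
Qed.

Lemma frac_cover (N : nat) (t : R) : 0 <= t <= 1 ->
  exists2 j : nat, (j < N.+1)%N & (j%:R / N.+1%:R : R) <= t <= (j.+1%:R / N.+1%:R : R).
Proof.
move=> /andP[t0 t1]; have N0 : 0 < N.+1%:R :> R by rewrite ltr0n.
(* At [t = 1] the integer part of [t * N.+1] would be [N.+1], one too many; the last closed interval
   takes this point. *)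
have [t1'|] := ltP t 1; last first.
  move=> t1'; exists N => //; rewrite divff ?gt_eqF // t1 andbT (le_trans _ t1') //.
  by rewrite ler_pdivrMr // mul1r ler_nat.
have tN0 : 0 <= t * N.+1%:R by rewrite mulr_ge0.
have /andP[l u] := truncn_itv tN0.
exists (Num.truncn (t * N.+1%:R)); last by rewrite ler_pdivrMr // ler_pdivlMr // l ltW.
rewrite -(ltr_nat R); apply: le_lt_trans l _.
by rewrite -[ltRHS]mul1r ltr_pM2r.
Qed.

Let integrand t := f (gam t) `^ r * (\prod_(i < d) (derive1 gam t) ord0 i) `^ r.

Lemma lower_step_ge0 N t : 0 <= lower_step N t.
Proof. by apply: sumr_ge0 => j _; rewrite !mulr_ge0 // powR_ge0. Qed.

(** On the box around [gam t], [f] loses at most a factor [kappa], and so does each of the [d]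
    increments against its linearization. The root of [kappa ^ (d + 1)] is at least
    [kappa ^ (d + 1)] itself. *)
Lemma lower_step_ge (t kappa : R) : 0 <= t <= 1 -> 0 < kappa < 1 ->
  \forall N \near \oo, kappa ^+ d.+1 * integrand t <= lower_step N t.
Proof.
move=> t01 k01; have /andP[k0 k1] := k01.
have dt0 i : 0 <= (derive1 gam t) ord0 i by exact: dgam0.
set D := \prod_(i < d) (derive1 gam t) ord0 i.
have D0 : 0 <= D by exact: prodr_ge0.
have r0 : r != 0 by rewrite invr_eq0 pnatr_eq0 -lt0n.
have [->|fD] := eqVneq (integrand t) 0.
  by apply: nearW => N; rewrite mulr0 lower_step_ge0.
have ft0 : 0 < f (gam t).
  rewrite lt_neqAle f0 andbT eq_sym; apply: contraNneq fD => ft.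
  by rewrite /integrand ft powR0 // mul0r.
have Dn0 : D != 0.
  by apply: contraNneq fD => Dz; rewrite /integrand -/D Dz powR0 // mulr0.
have L0 i : 0 < (derive1 gam t) ord0 i.
  by rewrite lt_neqAle dt0 andbT eq_sym; move/prodf_neq0: Dn0 => /(_ i isT).
have /nbhs_ballP[e /= e0 fe] := f_lsc k01 ft0.
have near_gam : \forall s \near t, ball (gam t) e (gam s).
  have /cvg_ball/(_ e e0) : gam @ t --> gam t.
    by apply/differentiable_continuous/derivable1_diffP/dgam.
  exact.
(* The tolerance is proportional to the derivative, which is positive here, so the error becomes a
   relative one. *)
have near_lin : \forall s \near t, forall i : 'I_d,
   `|gam s ord0 i - gam t ord0 i - (derive1 gam t) ord0 i * (s - t)|
     <= (1 - kappa) * (derive1 gam t) ord0 i * `|s - t|.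
  apply: (@filter_forall _ _ _ (nbhs t)) => i; rewrite -(coord_derive1 i t01).
  apply: derivable_linear_approx; first exact: coord_derivable.
  by rewrite coord_derive1 // mulr_gt0 // subr_gt0.
have [del Hdel] := nbhs_ex (filterI near_gam near_lin).
have [N0 _ HN0] := near_infty_natSinv_lt del.
exists N0 => // N /HN0 /= Ndel.
have N1 : 0 < N.+1%:R :> R by rewrite ltr0n.
have [j jN /andP[tl tr]] := frac_cover N t01.
set tj : R := j%:R / N.+1%:R in tl; set tj1 : R := j.+1%:R / N.+1%:R in tr.
have tjD : tj1 - tj = N.+1%:R^-1 by rewrite /tj1 /tj -mulrBl -natrB // subSnn mul1r.
have near_l : ball t del%:num tj.
  by rewrite /ball /= ger0_norm ?subr_ge0 //; apply: le_lt_trans Ndel; rewrite -tjD lerD2r.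
have near_r : ball t del%:num tj1.
  rewrite /ball /= distrC ger0_norm ?subr_ge0 //; apply: le_lt_trans Ndel.
  by rewrite -tjD lerD2l lerN2.
have [bl ll] := Hdel _ near_l; have [br lr] := Hdel _ near_r.
have dl i : kappa * (derive1 gam t) ord0 i * N.+1%:R^-1 <=
    node N j.+1 ord0 i - node N j ord0 i.
  have := ll i; have := lr i; rewrite /node -/tj -/tj1.
  rewrite (ger0_norm (_ : 0 <= tj1 - t)) ?subr_ge0 // (distrC tj t) (ger0_norm (_ : 0 <= t - tj)) ?subr_ge0 //.
  set L := (derive1 gam t) ord0 i.
  rewrite !ler_norml => /andP[h1 _] /andP[_ h2]; rewrite -tjD.
  have -> : kappa * L * (tj1 - tj) = L * (tj1 - t) - L * (tj - t)
     - (1 - kappa) * L * (tj1 - t) - (1 - kappa) * L * (t - tj) by ring.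
  lra.
have ab i : node N j ord0 i < node N j.+1 ord0 i.
  by rewrite -subr_gt0; apply: lt_le_trans (dl i); rewrite !mulr_gt0 ?invr_gt0.
have fl : kappa * f (gam t) <= floor_val N j.
  apply: lb_le_inf.
    exists (f (node N j)); exists (node N j) => //=; apply/forallP => i.
    by rewrite lexx ab.
  (* Each coordinate of [x] lies between those of two nodes in the ball around [gam t], and balls
     are taken coordinatewise. *)
  move=> _ [x /= /forallP xb <-]; apply: fe; split => // k i; rewrite (ord1 k).
  have := bl.2 ord0 i; have := br.2 ord0 i; have /andP[] := xb i.
  rewrite /ball /= /node -/tj -/tj1 !ltr_norml => x1 x2 /andP[h1 h2] /andP[h3 h4].
  by apply/andP; split; lra.
have vol : kappa ^+ d * D * (N.+1%:R^-1) ^+ d <= box_vol N j.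
  have -> : kappa ^+ d * D * (N.+1%:R^-1) ^+ d =
     \prod_(i < d) (kappa * (derive1 gam t) ord0 i * N.+1%:R^-1).
    by rewrite !big_split /= !prodr_const !card_ord.
  apply: ler_prod => i _; rewrite dl andbT.
  by rewrite !mulr_ge0 ?invr_ge0 // ltW.
apply: (@le_trans _ _ (N.+1%:R * (floor_val N j * box_vol N j) `^ r)); last first.
  rewrite /lower_step (bigD1 (Ordinal jN)) //= indicE.
  rewrite mem_set ?mulr1; last by rewrite /= in_itv /= -/tj -/tj1 tl tr.
  rewrite lerDl; apply: sumr_ge0 => i _.
  by rewrite !mulr_ge0 // powR_ge0.
have kd0 : 0 <= kappa ^+ d.+1 by rewrite exprn_ge0 // ltW.
apply: (@le_trans _ _ (N.+1%:R * ((kappa ^+ d.+1 * (f (gam t) * D)) * (N.+1%:R^-1) ^+ d) `^ r)).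
  rewrite powRM ?mulr_ge0 ?exprn_ge0 ?invr_ge0 //.
  have -> : (N.+1%:R^-1 ^+ d) `^ r = N.+1%:R^-1 :> R.
    by rewrite -powR_mulrn ?invr_ge0 // -powRrM divff ?pnatr_eq0 -?lt0n // powRr1 ?invr_ge0.
  rewrite [leRHS]mulrCA divff ?gt_eqF // mulr1 powRM ?mulr_ge0 // powRM // -/(integrand t).
  rewrite ler_wpM2r ?mulr_ge0 ?powR_ge0 //.
  rewrite -{1}[kappa ^+ d.+1]powRr1 // ger_powR //.
    by rewrite exprn_gt0 //= exprn_ile1 // ltW.
    by rewrite invf_le1 ?ltr0n // ler1n.
  exact: ltW.
apply: ler_wpM2l => //; apply: ge0_ler_powR; rewrite ?invr_ge0 ?nnegrE //.
- by rewrite !mulr_ge0 ?exprn_ge0 ?invr_ge0 // ltW.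
- by rewrite mulr_ge0 ?floor_val_ge0 ?box_vol_ge0.
have -> : kappa ^+ d.+1 * (f (gam t) * D) * N.+1%:R^-1 ^+ d =
  (kappa * f (gam t)) * (kappa ^+ d * D * N.+1%:R^-1 ^+ d) by rewrite exprS; ring.
by apply: ler_pM => //; rewrite !mulr_ge0 ?exprn_ge0 ?invr_ge0 // ltW.
Qed.

Lemma integral_lower_step N :
  (\int[lebesgue_measure]_(t in `[0%R, 1%R]) (lower_step N t)%:E = (lower_sum N)%:E)%E.
Proof.
have N0 : 0 < N.+1%:R :> R by rewrite ltr0n.
rewrite /lower_step; under eq_integral do rewrite -sumEFin.
rewrite ge0_integral_sum //; last 2 first.
- move=> j; apply/measurable_EFinP/measurable_funM => //.
- by move=> j t _; rewrite lee_fin !mulr_ge0 // powR_ge0.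
rewrite /lower_sum -sumEFin; apply: eq_bigr => j _.
under eq_integral do rewrite EFinM.
rewrite ge0_integralZl_EFin //; last 2 first.
- by apply/measurable_EFinP.
- by rewrite mulr_ge0 // powR_ge0.
rewrite integral_indic // setIidl; last first.
  move=> t /=; rewrite !in_itv /= => /andP[l u].
  have /andP[j0 _] := @frac01 N j (ltnW (ltn_ord j)); have /andP[_ j1] := @frac01 N j.+1 (ltn_ord j).
  by rewrite (le_trans j0) //= (le_trans u).
rewrite [X in (_ * X)%E](_ : _ = (N.+1%:R^-1)%:E); last first.
  apply: etrans (lebesgue_measure_itv _) _ => /=.
  rewrite lte_fin ltr_pM2r ?invr_gt0 // ltr_nat ltnSn -EFinB.
  by rewrite -mulrBl -natrB // subSnn mul1r.
by rewrite -EFinM mulrAC divff ?gt_eqF // mul1r.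
Qed.

(** The integrand is at most the pointwise lower limit of the step functions, whose integrals are
    the lower sums; Fatou's lemma exchanges limit and integral. *)
Lemma curve_integral_le_lower :
  (curve_integral f gam <= limn_einf (fun N => (lower_sum N)%:E))%E.
Proof.
rewrite /curve_integral.
have mstep N : measurable_fun (`[0%R, 1%R]%classic : set R) (fun t => (lower_step N t)%:E).
  apply/measurable_EFinP; apply: measurable_sum => j; apply: measurable_funM => //.
apply: (@le_trans _ _ (\int[lebesgue_measure]_(t in `[0%R, 1%R])
   limn_einf (fun N => (lower_step N t)%:E))%E).
  apply: ge0_le_integral_nonmeas => t; first by rewrite lee_fin mulr_ge0 ?powR_ge0.
  rewrite /= in_itv /= => t01; apply: (lee_expr_lim (k := d.+1)) => i.
  apply: limn_einf_ge; have := lower_step_ge t01 (frac_succ01 i).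
  by apply: filterS => N; rewrite lee_fin.
apply: le_trans (fatou _ _ _ _) _ => //.
  by move=> N t _; rewrite lee_fin lower_step_ge0.
by under eq_fun do rewrite integral_lower_step.
Qed.

End LowerSums.

(** * Almost sure lower bound *)

Lemma lt_ereal_rat (R : realType) (x y : \bar R) : (x < y)%E ->
  exists q : rat, (x < (ratr q)%:E < y)%E.
Proof.
have dense (u v : R) : u < v -> exists q : rat, u < ratr q < v.
  by move=> /rat_in_itvoo[q]; rewrite in_itv; exists q.
case: x y => [x| |] [y| |] // xy.
- by have [q] := dense _ _ xy; exists q.
- have [|q /andP[xq _]] := dense x (x + 1); first by rewrite ltrDl.
  by exists q; rewrite lte_fin xq ltry.
- have [|q /andP[_ qy]] := dense (y - 1) y; first by rewrite gtrBl.
  by exists q; rewrite lte_fin qy ltNyr.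
- by exists 0; rewrite ltry ltNyr.
Qed.

Section Assembly.
Context {R : realType} {d : nat}.
Notation vec := 'rV[R]_d.
Context {dT : measure_display} {T : measurableType dT} (P : probability T R).
Variables (c : R) (X : nat -> T -> vec) (f : vec -> R) (z : vec).
Hypothesis d0 : (0 < d)%N.
Hypothesis cd : is_cd d c.
Hypothesis iidX : iid_density P X f.
Hypothesis f0 : forall x, 0 <= f x.
Hypothesis f_lsc : forall (x : vec) (kappa : R), 0 < kappa < 1 -> 0 < f x ->
  \forall y \near x, kappa * f x <= f y.
Let r : R := d%:R^-1.

Let liminf_chain (w : T) : \bar R :=
  limn_einf (fun n : nat => ((n%:R `^ (- r)) * (u_n X n z w)%:R)%:E).

Lemma lower_sum_ae (gam : R -> vec) (N : nat) : admissible gam ->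
  (forall t, 0 <= t <= 1 -> lev (gam t) z) ->
  {ae P, forall w, ((c * lower_sum f gam N)%:E <= liminf_chain w)%E}.
Proof.
move=> [dgam [_ dgam0']] gamz; have [c0 _] := cd.
have dgam0 (t : R) : 0 <= t <= 1 -> forall i, 0 <= (derive1 gam t) ord0 i.
  by move=> /dgam0'[].
pose a j := node gam N j; pose v j := floor_val f gam N j * box_vol gam N j.
pose th := @frac_succ R.
(* Both [k] and [j] range over [nat], so that countably many null sets are joined; the bound on [j]
   stays inside as a hypothesis. *)
have box_ae : {ae P, forall w, forall k j : nat, (j < N.+1)%N -> \forall n \near \oo,
    th k ^+ 2 * c * v j `^ r * n%:R `^ r <= (chain_len X n (inbox (a j) (a j.+1)) w)%:R}.
  apply: ae_foralln => k; apply: ae_foralln => j.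
  have [jN|_] := boolP (j < N.+1)%N; last by apply: aeW.
  have V0 := box_vol_ge0 dgam dgam0 jN; have F0 := floor_val_ge0 gam f0 N j.
  (* A box with zero term may be degenerate, which the bound for one box excludes; its required
     chain length is 0. *)
  have [v0|v0] := eqVneq (v j) 0.
    apply: aeW => w _; apply: nearW => n.
    by rewrite v0 powR0 ?invr_eq0 ?pnatr_eq0 -?lt0n // mulr0 mul0r.
  have [Fn0 Vn0] : floor_val f gam N j != 0 /\ box_vol gam N j != 0.
    by move: v0; rewrite /v mulf_eq0 negb_or => /andP[].
  have ab i : a j ord0 i < a j.+1 ord0 i.
    rewrite lt_neqAle node_homo // andbT eq_sym -subr_eq0.
    by move/prodf_neq0: Vn0 => /(_ i isT).
  have Fp : 0 < floor_val f gam N j by rewrite lt_neqAle F0 andbT eq_sym.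
  have := box_chain_ae cd iidX d0 ab Fp f0 (fun x => @floor_val_le _ _ f gam f0 N j x) (frac_succ01 k).
  by apply: filterS => w H _.
apply: filterS box_ae => w H.
apply: (lee_expr_lim (k := 2)) => k; apply: limn_einf_ge.
have nearH : \forall n \near \oo, forall j : 'I_N.+1,
    th k ^+ 2 * c * v j `^ r * n%:R `^ r <= (chain_len X n (inbox (a j) (a j.+1)) w)%:R.
  by apply: filter_forall => j; apply: H.
near=> n.
have n0 : 0 < n%:R `^ r :> R by rewrite powR_gt0 // ltr0n; near: n; exists 1%N.
rewrite lee_fin powRN -ler_pdivrMl ?invr_gt0 // invrK.
apply: (@le_trans _ _ (\sum_(j < N.+1) chain_len X n (inbox (a j) (a j.+1)) w)%:R).
  rewrite natr_sum /lower_sum -/r !mulr_sumr; apply: ler_sum => j _.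
  have Hn : forall j : 'I_N.+1,
    th k ^+ 2 * c * v j `^ r * n%:R `^ r <= (chain_len X n (inbox (a j) (a j.+1)) w)%:R.
    by near: n.
  by apply: le_trans (Hn j); rewrite /th mulrC !mulrA.
rewrite ler_nat; apply: (@sum_chain_len_le _ _ _ X n w a (fun j => a j.+1) z N.+1 d0).
  move=> j j' /andP[jj' jN]; apply/forallP => i.
  by apply: node_homo => //; exact: ltnW.
move=> j jN; apply: gamz; exact: frac01.
Unshelve. all: by end_near.
Qed.

Lemma curve_integral_ae (gam : R -> vec) : admissible gam ->
  (forall t, 0 <= t <= 1 -> lev (gam t) z) ->
  {ae P, forall w, (c%:E * curve_integral f gam <= liminf_chain w)%E}.
Proof.
move=> agam gamz; have [c0 _] := cd; have [dgam [_ dgam0']] := agam.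
have dgam0 (t : R) : 0 <= t <= 1 -> forall i, 0 <= (derive1 gam t) ord0 i.
  by move=> /dgam0'[].
have : {ae P, forall w, forall N, ((c * lower_sum f gam N)%:E <= liminf_chain w)%E}.
  by apply: ae_foralln => N; exact: lower_sum_ae.
apply: filterS => w H; rewrite -lee_pdivlMl //.
apply: le_trans (curve_integral_le_lower d0 f0 f_lsc dgam dgam0) _.
by apply: limn_einf_le => N; rewrite lee_pdivlMl // -EFinM.
Qed.

(** The supremum runs over uncountably many curves. One curve is chosen for each rational exceeded
    by some curve integral, so countably many null sets suffice; a rational strictly between the
    lower limit and a curve integral then gives a contradiction. *)
Lemma Ufun_ae : {ae P, forall w, (c%:E * Ufun f z <= liminf_chain w)%E}.
Proof.
have [c0 _] := cd.
pose good (gam : R -> vec) := admissible gam /\ forall t, 0 <= t <= 1 -> lev (gam t) z.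
pose above (q : rat) := exists2 gam, good gam & ((ratr q)%:E < curve_integral f gam)%E.
have : {ae P, forall w, forall n : nat, forall q : rat, unpickle n = Some q -> above q ->
    (c%:E * (ratr q)%:E <= liminf_chain w)%E}.
  apply: ae_foralln => n; case: (unpickle n) => [q|]; last by apply: aeW.
  have [[gam [agam gamz] qgam]|nq] := pselect (above q); last first.
    by apply: aeW => w q' [<-].
  apply: filterS (curve_integral_ae agam gamz) => w Hw q' [<-] _.
  by apply: le_trans Hw; rewrite lee_pmul2l ?lte_fin // ltW.
apply: filterS => w H; rewrite -lee_pdivlMl //.
apply: ub_ereal_sup => _ [gam ggam <-]; rewrite leNgt; apply/negP => lt_gam.
have [q qgam qL] : exists2 q : rat, ((ratr q)%:E < curve_integral f gam)%E &
    ((c^-1)%:E * liminf_chain w < (ratr q)%:E)%E.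
  by have [q /andP[]] := lt_ereal_rat lt_gam; exists q.
have := H (pickle q) q (pickleK q) (ex_intro2 _ _ gam ggam qgam).
by rewrite -lee_pdivlMl // leNgt qL.
Qed.

End Assembly.

Unset Implicit Arguments.

Theorem theorem3p6 (R : realType) (d : nat) (c : R)
    (Omega : set 'rV[R]_d) (f : 'rV[R]_d -> R)
    (dT : measure_display) (T : measurableType dT) (P : probability T R)
    (X : nat -> T -> 'rV[R]_d) :
  (2 <= d)%N ->
  @is_cd R d c ->
  open Omega ->
  (exists M : R, forall x, Omega x -> eucl x <= M) ->
  lipschitz_boundary Omega ->
  (forall x, Omega x -> forall i, 0 < x ord0 i) ->
  prob_density f ->
  (exists m : R -> R,
      {within `[0, +oo[, continuous m} /\
      {in `[0, +oo[ &, {homo m : s t / s <= t}} /\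
      (forall s, 0 <= s -> 0 <= m s) /\ m 0 = 0 /\
      (forall x y, Omega x -> Omega y -> `|f x - f y| <= m (eucl (x - y)))) ->
  (forall x, ~ Omega x -> f x = 0) ->
  iid_density P X f ->
  forall z : 'rV[R]_d,
    {ae P, forall w,
      (c%:E * Ufun f z <=
       limn_einf (fun n : nat => ((n%:R `^ (- (d%:R)^-1)) * (u_n X n z w)%:R)%:E))%E}.
Proof.
move=> d2 cd oO _ _ _ [_ [f0 _]] [m [cm [_ [_ [m0 fm]]]]] fO iidX z.
apply: (Ufun_ae z (leq_trans (isT : (0 < 2)%N) d2) cd iidX f0).
exact: modulus_lsc oO cm m0 fm fO.
Qed.
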